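(* Let assumptions (A1) and (A2a) be satisfied and assume that $\kappa^2>0$. For any positive sequence $a_{N,T}$ choose $\lambda_{N,T}=4a_{N,T}p^{1/r}(NT)^{1/2}\max_{1\le t\le T}\|\epsilon_{1,t}\|_{L_r}$ and $\mu_{N,T}=4a_{N,T}N^{1/r}T^{1/2}\max_{1\le t\le T}\|\epsilon_{1,t}\|_{L_r}$. Then $$P(\mathcal{A}_{N,T}\cap\mathcal{B}_{N,T})\ge 1-2\left(\frac{C_r}{a_{N,T}}\right)^r-D_r\frac{(p^2+Np)(s_1+s_2)^{r/2}\left(\frac pN\vee\frac Np\right)}{\kappa^rN^{r/4}}$$ for constants $C_r$ and $D_r$ depending only on $r$. Furthermore, with at least this probability (namely on $\mathcal{A}_{N,T}\cap\mathcal{B}_{N,T}$), $$\|\hat\beta-\beta^*\|\le\frac{\xi_{N,T}}{\sqrt{NT}}\qquad\text{and}\qquad\|\hat c-c^*\|\le\frac{\xi_{N,T}}{\sqrt T},$$ where $\xi_{N,T}=32a_{N,T}\max_{1\le t\le T}\|\epsilon_{1,t}\|_{L_r}\left(p^{1/r}\sqrt{s_1}+N^{1/r}\sqrt{s_2}\right)/\kappa^2$.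
   Context: Model: for $i=1,\dots,N$, $t=1,\dots,T$, $y_{i,t}=x_{i,t}'\beta^*+c_i^*+\epsilon_{i,t}$ with random covariates $x_{i,t}=(x_{i,t,1},\dots,x_{i,t,p})'\in\mathbb{R}^p$, unknown deterministic vectors $\beta^*\in\mathbb{R}^p$, $c^*\in\mathbb{R}^N$ and random errors $\epsilon_{i,t}$. Put $X_i=(x_{i,1},\dots,x_{i,T})'$, $X=(X_1',\dots,X_N')'$, $\epsilon_i=(\epsilon_{i,1},\dots,\epsilon_{i,T})'$, $\epsilon=(\epsilon_1',\dots,\epsilon_N')'$, $y$ stacked in the same way, $D=I_N\otimes\iota$ with $\iota$ the $T\times1$ vector of ones, $Z=(X,D)$, $\gamma^*=({\beta^*}',{c^*}')'$, so $y=Z\gamma^*+\epsilon$. Let $s_1=|\{j:\beta_j^*\ne0\}|$, $s_2=|\{i:c_i^*\neq0\}|$. $\|\cdot\|$, $\|\cdot\|_{\ell_1}$, $\|\cdot\|_{\ell_\infty}$ are the $\ell_2$-, $\ell_1$- and $\ell_\infty$-norms; $\|U\|_{L_r}=(E|U|^r)^{1/r}$; $a\vee b=\max(a,b)$; $v_A$ is the subvector of $v$ indexed by $A$. Panel Lasso: $\hat\gamma=(\hat\beta',\hat c')'$ minimizes $\|y-Z\gamma\|^2+2\lambda_{N,T}\|\beta\|_{\ell_1}+2\mu_{N,T}\|c\|_{\ell_1}$ over $\gamma=(\beta',c')'\in\mathbb{R}^{p+N}$. Restricted eigenvalues: let $S=\mathrm{diag}(\sqrt{NT}\,I_p,\sqrt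 T\,I_N)$, $\Psi_{N,T}=S^{-1}Z'ZS^{-1}$ and $\Gamma=\mathrm{diag}(E(X'X/(NT)),I_N)$ (block diagonal). For a positive semi-definite $(p+N)\times(p+N)$ matrix $M$ let $\kappa_M^2(r_1,r_2)$ be the minimum of $\delta'M\delta/\|\delta\|^2$ over all $\delta=({\delta^1}',{\delta^2}')'\in\mathbb{R}^{p+N}\setminus\{0\}$ ($\delta^1\in\mathbb{R}^p$, $\delta^2\in\mathbb{R}^N$) and all $R_1\subseteq\{1,\dots,p\}$, $R_2\subseteq\{1,\dots,N\}$ with $|R_1|\le r_1$, $|R_2|\le r_2$ and $\frac{\lambda_{N,T}}{\sqrt{NT}}\|\delta^1_{R_1^c}\|_{\ell_1}+\frac{\mu_{N,T}}{\sqrt T}\|\delta^2_{R_2^c}\|_{\ell_1}\le 3\frac{\lambda_{N,T}}{\sqrt{NT}}\|\delta^1_{R_1}\|_{\ell_1}+3\frac{\mu_{N,T}}{\sqrt T}\|\delta^2_{R_2}\|_{\ell_1}$. Write $\kappa^2=\kappa^2_\Gamma(s_1,s_2)$, $\kappa=\sqrt{\kappa^2}$ and $\kappa^2_{\Psi_{N,T}}=\kappa^2_{\Psi_{N,T}}(s_1,s_2)$. Events: $\mathcal{A}_{N,T}=\{\|X'\epsilon\|_{\ell_\infty}\le\lambda_{N,T}/2,\ \|D'\epsilon\|_{\ell_\infty}\le\mu_{N,T}/2\}$, $\mathcal{B}_{N,T}=\{\kappa^2_{\Psi_{N,T}}\ge\kappa^2/2\}$. (A1): (a) $\{(X_i,\epsilon_i)\}_{i=1}^N$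 are independent and identically distributed; (b) $X_i$ and $\epsilon_i$ are independent for each $i$; (c) for each $i$, $\{\epsilon_{i,t},\mathcal{F}_{i,t}\}_{t=1}^T$ with $\mathcal{F}_{i,t}=\sigma(\epsilon_{i,1},\dots,\epsilon_{i,t})$ is a martingale difference sequence ($E(\epsilon_{i,t}\mid\mathcal{F}_{i,t-1})=0$, $\mathcal F_{i,0}$ trivial). (A2a): for some $r\ge2$, $E|x_{1,t,k}|^r<\infty$ and $E|\epsilon_{1,t}|^r<\infty$ for all $t=1,\dots,T$, $k=1,\dots,p$, with the normalization $\max_{1\le t\le T}E|x_{1,t,k}|^r\le1$ for all $k$.
   Formalization: The probability bound is stated assuming the maximal L_r-norm of the errors is positive; with errors a.s. zero both penalties vanish, the cone is the whole space, and the bound can fail (e.g. T=p=1, Rademacher covariates, r>8, a and N large). *)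

(* Defs.v *)
(* MathComp + MathComp-Analysis *)
From HB Require Import structures.
From mathcomp Require Import all_boot all_order all_algebra.
From mathcomp Require Import all_classical all_reals all_analysis.

Set Implicit Arguments.
Unset Strict Implicit.
Unset Printing Implicit Defensive.

Import Order.TTheory GRing.Theory Num.Theory.
Import numFieldNormedType.Exports.

Local Open Scope classical_set_scope.
Local Open Scope ring_scope.

Section norms.
Context {R : realType} {n : nat}.
Implicit Types (v : 'cV[R]_n) (A : {set 'I_n}).

Definition l2norm v : R := Num.sqrt (\sum_i v i 0 ^+ 2).

Definition l1norm_on A v : R := \sum_(i in A) `|v i 0|.

Definition l1norm v : R := \sum_i `|v i 0|.

Definition linfnorm v : R := \big[Num.max/0]_i `|v i 0|.

Definition sparsity v : nat := #|[set i | v i 0 != 0]|.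

End norms.

Section probability_notions.
Context {d : measure_display} {Omega : measurableType d} {R : realType}.
Variable P : probability Omega R.

Definition identically_distributed {I : Type} {d' : measure_display}
    {E : measurableType d'} (f : I -> Omega -> E) : Prop :=
  forall (i j : I) (B : set E), measurable B ->
    pushforward P (f i) B = pushforward P (f j) B.

Definition mutually_independent {I : finType} {d' : measure_display}
    {E : measurableType d'} (f : I -> Omega -> E) : Prop :=
  forall (J : {set I}) (B : I -> set E), (forall i, measurable (B i)) ->
    P (\bigcap_(i in [set` J]) f i @^-1` B i) =
    (\big[*%E/1]_(i in J) P (f i @^-1` B i))%E.

Definition independent {d1 d2 : measure_display} {E1 : measurableType d1}
    {E2 : measurableType d2} (f : Omega -> E1) (g : Omega -> E2) : Prop :=
  forall (A : set E1) (B : set E2), measurable A -> measurable B ->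
    P (f @^-1` A `&` g @^-1` B) = (P (f @^-1` A) * P (g @^-1` B))%E.

(* [g] is a version of the conditional expectation E(f | G), for a
   sub-sigma-algebra [G]. *)
Definition is_cond_expectation (G : set (set Omega)) (f g : Omega -> R) :
    Prop :=
  [/\ forall B : set R, measurable B -> G (g @^-1` B),
      P.-integrable setT (EFin \o g) &
      forall A, G A ->
        (\int[P]_(w in A) (g w)%:E = \int[P]_(w in A) (f w)%:E)%E].

(* With time indexed from 0, [natural_filtration e k] is generated by the first
   [k] variables: for [k = 0] it is the trivial sigma-algebra. *)
Definition natural_filtration {T : nat} (e : 'I_T -> Omega -> R) (k : nat) :
    set (set Omega) :=
  <<s \bigcup_(s in [set s : 'I_T | (s < k)%N])
        preimage_set_system setT (e s) measurable >>.

Definition martingale_difference {T : nat} (e : 'I_T -> Omega -> R)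
    (F : nat -> set (set Omega)) : Prop :=
  forall t : 'I_T,
    [/\ forall B : set R, measurable B -> F t.+1 (e t @^-1` B),
        P.-integrable setT (EFin \o e t) &
        is_cond_expectation (F t) (e t) (cst 0)].

Definition max_Lrnorm {T : nat} (r : R) (e : 'I_T -> Omega -> R) : R :=
  \big[Num.max/0]_(t < T) fine ('N[P]_(r%:E)[EFin \o e t])%E.

End probability_notions.

Section design.
Context {R : realType} {N T p : nat}.

(* The stacked dimension NT is written [\sum_(i < N) T], as required by
   [\mxcol]. *)
Definition stack {n : nat} (A : 'I_N -> 'M[R]_(T, n)) :
    'M[R]_(\sum_(i < N) T, n) := \mxcol_(i < N) A i.

(* D = I_N (x) iota: its i-th T x N block row is iota e_i'. *)
Definition dummies : 'M[R]_(\sum_(i < N) T, N) :=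
  stack (fun i => (const_mx 1 : 'cV[R]_T) *m (delta_mx 0 i : 'rV[R]_N)).

Definition scaling : 'M[R]_(p + N) :=
  block_mx (Num.sqrt (N%:R * T%:R))%:M 0 0 (Num.sqrt T%:R)%:M.

Definition Psi (X : 'M[R]_(\sum_(i < N) T, p)) : 'M[R]_(p + N) :=
  let Z := row_mx X dummies in
  invmx scaling *m (Z^T *m Z) *m invmx scaling.

Definition lasso_objective (X : 'M[R]_(\sum_(i < N) T, p))
    (y : 'cV[R]_(\sum_(i < N) T)) (lam mu : R)
    (b : 'cV[R]_p) (c : 'cV[R]_N) : R :=
  l2norm (y - row_mx X dummies *m col_mx b c) ^+ 2
  + 2 * lam * l1norm b + 2 * mu * l1norm c.

Definition is_panel_lasso (X : 'M[R]_(\sum_(i < N) T, p))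
    (y : 'cV[R]_(\sum_(i < N) T)) (lam mu : R)
    (bhat : 'cV[R]_p) (chat : 'cV[R]_N) : Prop :=
  forall (b : 'cV[R]_p) (c : 'cV[R]_N),
    lasso_objective X y lam mu bhat chat <= lasso_objective X y lam mu b c.

Definition restricted_cone (lam mu : R) (r1 r2 : nat) : set 'cV[R]_(p + N) :=
  [set delta | delta != 0 /\
    exists (R1 : {set 'I_p}) (R2 : {set 'I_N}),
      [/\ (#|R1| <= r1)%N, (#|R2| <= r2)%N &
        lam / Num.sqrt (N%:R * T%:R) * l1norm_on (~: R1)%SET (usubmx delta)
        + mu / Num.sqrt T%:R * l1norm_on (~: R2)%SET (dsubmx delta)
        <= 3 * (lam / Num.sqrt (N%:R * T%:R)) * l1norm_on R1 (usubmx delta)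
           + 3 * (mu / Num.sqrt T%:R) * l1norm_on R2 (dsubmx delta)]].

(* The minimum is taken in [\bar R]: it is attained when the cone is nonempty.
   The cone is empty when r1 = r2 = 0 and lam, mu > 0; the value is then +oo. *)
Definition kappa2 (lam mu : R) (M : 'M[R]_(p + N)) (r1 r2 : nat) : \bar R :=
  ereal_inf [set ((delta^T *m M *m delta) 0 0 / l2norm delta ^+ 2)%:E
            | delta in restricted_cone lam mu r1 r2].

End design.
Arguments dummies R N T : clear implicits.
Arguments kappa2 {R N} T {p} lam mu M r1 r2.

Section panel.
Context {d : measure_display} {Omega : measurableType d} {R : realType}.
Variable P : probability Omega R.
Context {N T p : nat}.
Variables (x : 'I_N -> 'I_T -> 'I_p -> Omega -> R)
          (eps : 'I_N -> 'I_T -> Omega -> R).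

Definition covariate_matrix (w : Omega) : 'M[R]_(\sum_(i < N) T, p) :=
  stack (fun i => \matrix_(t < T, k < p) x i t k w).

(* Stacks any scalar panel, e.g. the errors or the responses. *)
Definition stacked_vector (u : 'I_N -> 'I_T -> Omega -> R) (w : Omega) :
    'cV[R]_(\sum_(i < N) T) :=
  stack (fun i => \col_(t < T) u i t w).

Definition Gamma : 'M[R]_(p + N) :=
  block_mx
    (\matrix_(k, l) fine ('E_P[fun w =>
       (((covariate_matrix w)^T *m covariate_matrix w) k l
        / (N%:R * T%:R))%R])%E)
    0 0 1%:M.

(* The random elements X_i and epsilon_i, with the product sigma-algebras of
   the tuple types. *)
Definition Xvec (i : 'I_N) (w : Omega) : T.-tuple (p.-tuple R) :=
  [tuple [tuple x i t k w | k < p] | t < T].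

Definition epsvec (i : 'I_N) (w : Omega) : T.-tuple R :=
  [tuple eps i t w | t < T].

Definition assumption_A1 : Prop :=
  [/\ mutually_independent P (fun i w => (Xvec i w, epsvec i w)),
      identically_distributed P (fun i w => (Xvec i w, epsvec i w)),
      forall i, independent P (Xvec i) (epsvec i) &
      forall i, martingale_difference P (eps i) (natural_filtration (eps i))].

(* [i1] is the first individual. *)
Definition assumption_A2a (r : R) (i1 : 'I_N) : Prop :=
  [/\ forall t k, ('E_P[fun w => (`|x i1 t k w| `^ r)%R] < +oo)%E,
      forall t, ('E_P[fun w => (`|eps i1 t w| `^ r)%R] < +oo)%E &
      forall k, (\big[maxe/0]_(t < T) 'E_P[fun w => (`|x i1 t k w| `^ r)%R] <= 1)%E].

Definition event_A (lam mu : R) : set Omega :=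
  [set w | linfnorm ((covariate_matrix w)^T *m stacked_vector eps w) <= lam / 2
        /\ linfnorm ((dummies R N T)^T *m stacked_vector eps w) <= mu / 2].

Definition event_B (lam mu : R) (s1 s2 : nat) : set Omega :=
  [set w | (kappa2 T lam mu Gamma s1 s2 * (2^-1)%:E
            <= kappa2 T lam mu (Psi (covariate_matrix w)) s1 s2)%E].

End panel.

(* Main.v *)
Require Import Defs.
From HB Require Import structures.
From mathcomp Require Import all_boot all_order all_algebra.
From mathcomp Require Import all_classical all_reals all_analysis.
From mathcomp Require Import measurable_realfun.
From mathcomp Require Import ring lra.

Set Implicit Arguments.
Unset Strict Implicit.
Unset Printing Implicit Defensive.

Import Order.TTheory GRing.Theory Num.Theory.
Import numFieldNormedType.Exports.

Local Open Scope classical_set_scope.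
Local Open Scope ring_scope.

(** The error bounds are deterministic on the two events.  Comparing the Lasso
    objective at the estimator and at the true parameter, the first event lets
    one half of the penalty absorb the noise, and the other half forces the
    scaled error into the cone of the restricted eigenvalue ([lasso_basic],
    [lasso_cone]); on the second event the quadratic form of the design is then
    at least half of [kappa^2] times the squared error, while it is at most
    linear in the error ([lasso_quad_le], [lasso_error]).

    Both probabilities rest on one moment inequality, [moment_sum_le]: if each
    increment [d_k] is orthogonal to [S_k |S_k|^(r-2)], where [S_k] is the sum
    of the earlier increments, then
    [E |S_n|^r <= C_r n^(r/2-1) (E |d_1|^r + ... + E |d_n|^r)].  It follows from
    a pointwise second-order bound of [|x + y|^r] and a discrete Gronwall
    argument.  The orthogonality is checked on events: a function of the past
    is approximated by simple functions ([Rintegral_mul_eq0]), and for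
    independent variables the events of the past are reached from a pi-system
    ([independent_martingale]).  So the inequality covers martingale differences
    with deterministic weights ([moment_martingale_le]) as well as centred
    independent variables ([moment_independent_le]).

    For the first event, the coordinate [k] of [X' eps] is a sum over the
    individuals of independent scores, and each score is, given the covariates,
    a weighted sum of martingale differences.  As covariates and errors are
    independent, the conditioning is Tonelli's theorem on the product of their
    laws ([ge0_integral_independent], [score_moment]).  The inequality is thus
    used twice, over time and over individuals, which gives the square in the
    constant; the bound for [D' eps] uses it once.  Markov's inequality and a
    union bound conclude ([event_A_prob]).

    For the second event, the l1-norm is comparable to the l2-norm on the cone
    ([cone_l1norm_le]), up to the sparsity and the ratio of the two scaled
    penalty levels.  Hence an entrywise approximation of [Gamma] by the
    empirical matrix preserves half of the restricted eigenvalue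
    ([kappa2_perturb]).  The entries are averages over independent individuals,
    controlled by moments of order [r/2]; the moment inequality asks for
    [r/2 >= 2] ([event_B_prob_ge4]).  When [r < 4] and the cone is nonempty the
    stated lower bound is nonpositive, because [kappa^2 <= 1] ([ksq_le1], [remainder_ge1]).  Since
    the restricted eigenvalue is an infimum over uncountably many vectors, the
    measurability of the event needs an argument: its complement is a countable
    union of boxes with rational centres ([measurable_quadratic_event]).  If
    the sparsity is zero the cone is empty ([cone_empty]), both restricted
    eigenvalues are infinite, and the second event is certain. *)

(** * Pointwise inequalities for powers *)

(** [expR v - 1 - v <= v * (expR v - 1)] is the tangent bound
    [1 - v <= expR (- v)] multiplied by [expR v]; bounding [expR v - 1] once
    more by the tangent gives the second order. *)
Lemma expR_le_taylor2 (R : realType) (v b : R) : `|v| <= b ->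
  expR v <= 1 + v + v ^+ 2 * expR b.
Proof.
move=> vb.
have E0 := expR_gt0 v; have E1 := expR_ge1Dx v; have E2 := expR_ge1Dx (- v).
have E3 : expR v * expR (- v) = 1 by rewrite -expRD subrr expR0.
have vleb : v <= b by apply: le_trans vb; exact: ler_norm.
have Eb : expR v <= expR b by rewrite ler_expR.
have b0 : 0 <= b by apply: le_trans vb.
have E1b : 1 <= expR b by rewrite -expR0 ler_expR.
have key : expR v - 1 <= v * expR v by nra.
have [v0|v0] := leP 0 v; nra.
Qed.

Section power_pointwise.
Context {R : realType}.
Implicit Types x y u w r : R.

Definition powR_const r : R := 3 `^ r + 2 * r + r ^+ 2 * expR r + 1.

Lemma powR_const_ge1 r : 0 <= r -> 1 <= powR_const r.
Proof.
move=> r0; rewrite /powR_const lerDr.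
by rewrite !addr_ge0 ?powR_ge0 ?mulr_ge0 ?expR_ge0 ?sqr_ge0.
Qed.

(** For small [u] the bound comes from [ln (1 + u) <= u] and the second-order
    bound on the exponential; for large [u] the term [`|u| `^ r] dominates. *)
Lemma powR_add1_le r u : 2 <= r ->
  `|1 + u| `^ r <= 1 + r * u + powR_const r * (u ^+ 2 + `|u| `^ r).
Proof.
move=> r2; have r0 : 0 <= r by lra.
have p3 : 0 <= 3 `^ r :> R by exact: powR_ge0.
have e0 : 0 <= r ^+ 2 * expR r by rewrite mulr_ge0 ?sqr_ge0 ?expR_ge0.
have ur0 : 0 <= `|u| `^ r by exact: powR_ge0.
have u20 : 0 <= u ^+ 2 by exact: sqr_ge0.
have [us|ub] := lerP `|u| 2^-1.
  have u1 : 0 < 1 + u by move: us; rewrite ler_norml; lra.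
  rewrite (ger0_norm (ltW u1)).
  have -> : (1 + u) `^ r = expR (r * ln (1 + u)).
    by rewrite /powR gt_eqF.
  have lnu : ln (1 + u) <= u by apply: le_ln1Dx; lra.
  have ru : `|r * u| <= r.
    rewrite normrM (ger0_norm r0) -[leRHS]mulr1 ler_wpM2l //; lra.
  have := expR_le_taylor2 ru.
  have : expR (r * ln (1 + u)) <= expR (r * u) by rewrite ler_expR ler_wpM2l.
  move=> h1 h2; apply: (le_trans h1); apply: (le_trans h2).
  rewrite lerD2l exprMn /powR_const; nra.
have h1 : `|1 + u| `^ r <= 3 `^ r * `|u| `^ r.
  rewrite -powRM // ge0_ler_powR ?nnegrE ?mulr_ge0 //.
  by apply: le_trans (ler_normD _ _) _; rewrite normr1; lra.
have h2 : - (r * u) <= 2 * r * u ^+ 2.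
  have : - u <= `|u| by rewrite -normrN ler_norm.
  have -> : u ^+ 2 = `|u| ^+ 2 by rewrite real_normK ?num_real.
  move=> nu; have : r * (- u) <= r * (2 * `|u| ^+ 2).
    by rewrite ler_wpM2l //; apply: le_trans nu _; nra.
  lra.
apply: (le_trans h1); rewrite /powR_const; nra.
Qed.

(** The derivative of [x |-> `|x| `^ r] divided by [r]. *)
Definition spow r x : R := x * `|x| `^ (r - 2).

Lemma powR_add_le r x y : 2 <= r ->
  `|x + y| `^ r <= `|x| `^ r + r * (spow r x * y)
    + powR_const r * (`|x| `^ (r - 2) * y ^+ 2 + `|y| `^ r).
Proof.
move=> r2; have r0 : 0 < r by lra.
have K1 := powR_const_ge1 (ltW r0).
(* The inequality is homogeneous: for nonzero x it is the previous lemma at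
   y / x. *)
have [->|x0] := eqVneq x 0.
  rewrite /spow add0r normr0 powR0 ?gt_eqF // !mul0r mulr0 !add0r.
  have h1 : 0 <= 0 `^ (r - 2) * y ^+ 2 by rewrite mulr_ge0 ?powR_ge0 ?sqr_ge0.
  have h2 : 0 <= `|y| `^ r by exact: powR_ge0.
  nra.
have ax : 0 < `|x| by rewrite normr_gt0.
have xr : `|x| `^ r = `|x| ^+ 2 * `|x| `^ (r - 2).
  rewrite -powR_mulrn ?normr_ge0 // -powRD.
    by congr (_ `^ _); lra.
  by rewrite (gt_eqF ax) implybT.
have -> : `|x + y| `^ r = `|x| `^ r * `|1 + y / x| `^ r.
  by rewrite -powRM // -normrM mulrDr mulr1 mulrCA divff // mulr1.
have := ler_wpM2l (powR_ge0 `|x| r) (powR_add1_le (y / x) r2).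
move/le_trans; apply; rewrite mulrDr mulrDr mulr1.
have -> : `|x| `^ r * (r * (y / x)) = r * (spow r x * y).
  rewrite xr real_normK ?num_real // /spow; field.
  exact: x0.
rewrite lerD2l mulrCA.
rewrite ler_wpM2l ?(le_trans ler01) // mulrDr.
rewrite -powRM // -normrM (_ : x * (y / x) = y); last by field.
rewrite lerD2r xr real_normK ?num_real //.
by rewrite le_eqVlt; apply/orP; left; apply/eqP; field.
Qed.

(** A weighted form of Young's inequality, by splitting at [w = u / sqrt n]:
    below it the first term suffices, above it the second. *)
Lemma powR_young r u w n : 2 <= r -> 0 <= u -> 0 <= w -> 1 <= n ->
  u `^ (r - 2) * w ^+ 2 <= u `^ r / n + n `^ (r / 2 - 1) * w `^ r.
Proof.
move=> r2 u0 w0 n1; have n0 : 0 < n by lra.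
have r20 : 0 <= r - 2 by lra.
have split2 z : 0 <= z -> z `^ r = z `^ (r - 2) * z ^+ 2.
  move=> z0; rewrite -powR_mulrn // -powRD; first by congr (_ `^ _); lra.
  by apply/implyP => /eqP h; exfalso; lra.
have h0 : 0 <= n `^ (r / 2 - 1) * w `^ r by rewrite mulr_ge0 ?powR_ge0.
have h0' : 0 <= u `^ r / n by rewrite divr_ge0 ?powR_ge0 // ltW.
have [h|h] := lerP (n * w ^+ 2) (u ^+ 2).
  rewrite -[leLHS]addr0 lerD // (split2 _ u0) -mulrA ler_wpM2l ?powR_ge0 //.
  by rewrite ler_pdivlMr // mulrC.
rewrite -[leLHS]add0r lerD // (split2 _ w0) mulrA ler_wpM2r ?sqr_ge0 //.
have -> : n `^ (r / 2 - 1) = Num.sqrt n `^ (r - 2).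
  by rewrite -(powR12_sqrt (ltW n0)) -powRrM; congr (_ `^ _); lra.
rewrite -powRM ?sqrtr_ge0 // ge0_ler_powR ?nnegrE //.
  by rewrite mulr_ge0 ?sqrtr_ge0.
rewrite -(ler_sqr (x := u)) ?nnegrE ?mulr_ge0 ?sqrtr_ge0 //.
by rewrite exprMn sqr_sqrtr ltW.
Qed.

Lemma norm_spow r x : 2 <= r -> `|spow r x| = `|x| `^ (r - 1).
Proof.
move=> r2; rewrite /spow normrM (ger0_norm (powR_ge0 _ _)).
have -> : r - 2 = (r - 1) - 1 by lra.
by rewrite mulr_powRB1 ?normr_ge0 //; lra.
Qed.

Lemma spow_mul_le r x y : 2 <= r -> `|spow r x * y| <= `|x| `^ r + `|y| `^ r.
Proof.
move=> r2; rewrite normrM norm_spow //.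
have [h|h] := lerP `|x| `|y|.
  rewrite -[leLHS]add0r lerD ?powR_ge0 //.
  rewrite -[leRHS](@mulr_powRB1 _ `|y| r) //; last by lra.
  by rewrite mulrC ler_wpM2l // ge0_ler_powR ?nnegrE //; lra.
rewrite -[leLHS]addr0 lerD ?powR_ge0 //.
rewrite -[leRHS](@mulr_powRB1 _ `|x| r) //; last by lra.
by rewrite mulrC ler_wpM2r ?powR_ge0 // ltW.
Qed.

Lemma powR_norm_add_le r x y : 0 <= r ->
  `|x + y| `^ r <= 2 `^ r * (`|x| `^ r + `|y| `^ r).
Proof.
move=> r0.
have h z : `|x| <= z -> `|y| <= z -> `|x + y| `^ r <= 2 `^ r * z `^ r.
  move=> xz yz; have z0 : 0 <= z by apply: le_trans xz.
  rewrite -powRM // ge0_ler_powR ?nnegrE ?mulr_ge0 //.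
  by rewrite mulr_natl mulr2n (le_trans (ler_normD _ _)) ?lerD.
have [xy|xy] := lerP `|x| `|y|.
  apply: le_trans (h _ xy (lexx _)) _.
  by rewrite ler_wpM2l ?powR_ge0 // lerDr powR_ge0.
apply: le_trans (h _ (lexx _) (ltW xy)) _.
by rewrite ler_wpM2l ?powR_ge0 // lerDl powR_ge0.
Qed.

End power_pointwise.

(** * A moment inequality for sums of orthogonal increments *)

Section real_integrable.
Context {d : measure_display} {Omega : measurableType d} {R : realType}.
Variable mu : {measure set Omega -> \bar R}.
Implicit Types f g : Omega -> R.

Definition rintegrable f := mu.-integrable setT (EFin \o f).

Lemma rintegrable_measurable f : rintegrable f -> measurable_fun setT f.
Proof. by move/measurable_int/measurable_EFinP. Qed.

Lemma rintegrableD f g : rintegrable f -> rintegrable g ->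
  rintegrable (fun w => f w + g w).
Proof. by move=> hf hg; exact: (integrableD measurableT hf hg). Qed.

Lemma rintegrableZ k f : rintegrable f -> rintegrable (fun w => k * f w).
Proof. by move=> hf; exact: (integrableZl measurableT k hf). Qed.

Lemma rintegrableB f g : rintegrable f -> rintegrable g ->
  rintegrable (fun w => f w - g w).
Proof. by move=> hf hg; exact: (integrableB measurableT hf hg). Qed.

Lemma rintegrable_le f g : measurable_fun setT f ->
  (forall w, `|f w| <= g w) -> rintegrable g -> rintegrable f.
Proof.
move=> mf fg; apply: le_integrable => //; first exact/measurable_EFinP.
move=> w _ /=; rewrite lee_fin; apply: le_trans (fg w) _; exact: ler_norm.
Qed.

Lemma rintegrable0 : rintegrable (fun=> 0).
Proof. exact: integrable0. Qed.

Lemma Rintegral_nneg f : (forall w, 0 <= f w) -> 0 <= \int[mu]_w f w.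
Proof. by move=> f0; exact: Rintegral_ge0. Qed.

Lemma EFin_Rintegral f : rintegrable f ->
  (\int[mu]_w (f w)%:E = (\int[mu]_w f w)%:E)%E.
Proof. by move=> intf; rewrite /Rintegral fineK // integrable_fin_num. Qed.

Lemma rintegrable_ge0 f : measurable_fun setT f -> (forall w, 0 <= f w) ->
  (\int[mu]_w (f w)%:E < +oo)%E -> rintegrable f.
Proof.
move=> mf f0 ioo; apply/integrableP; split; first exact/measurable_EFinP.
by under eq_integral do rewrite /= ger0_norm //.
Qed.

Lemma measurable_powR_norm r f : measurable_fun setT f ->
  measurable_fun setT (fun w => `|f w| `^ r).
Proof.
move=> mf; apply: (measurableT_comp (measurable_powR r)).
exact: measurableT_comp.
Qed.

Lemma measurable_spow r : measurable_fun setT (@spow R r).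
Proof.
apply: measurable_funM => //.
apply: (measurableT_comp (measurable_powR _)); exact: normr_measurable.
Qed.

Definition moment_finite r f :=
  measurable_fun setT f /\ rintegrable (fun w => `|f w| `^ r).

Lemma moment_finite0 r : r != 0 -> moment_finite r (fun=> 0).
Proof.
move=> r0; split => //.
by rewrite normr0 powR0 //; exact: rintegrable0.
Qed.

Lemma moment_finiteD r f g : 0 <= r ->
  moment_finite r f -> moment_finite r g -> moment_finite r (fun w => f w + g w).
Proof.
move=> r0 [mf rf] [mg rg]; have mfg := measurable_funD mf mg; split => //.
apply: rintegrable_le (measurable_powR_norm _ mfg) _
  (rintegrableZ (2 `^ r) (rintegrableD rf rg)).
by move=> w; rewrite ger0_norm ?powR_ge0 // powR_norm_add_le.
Qed.

Lemma moment_finiteZ r k f :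
  moment_finite r f -> moment_finite r (fun w => k * f w).
Proof.
move=> [mf rf]; split; first exact: measurable_funM.
apply: eq_integrable (rintegrableZ (`|k| `^ r) rf) => // w _ /=.
by rewrite normrM powRM.
Qed.

Lemma moment_finite_sum r (I : Type) (s : seq I) (Q : pred I)
    (f : I -> Omega -> R) : 0 < r ->
  (forall i, Q i -> moment_finite r (f i)) ->
  moment_finite r (fun w => \sum_(i <- s | Q i) f i w).
Proof.
move=> r0 rf; elim: s => [|i s IH].
  under eq_fun do rewrite big_nil; apply: moment_finite0; exact: lt0r_neq0.
have [Qi|/negbTE Qi] := boolP (Q i); under eq_fun do rewrite big_cons Qi //.
  by apply: moment_finiteD (rf _ Qi) IH; exact: ltW.
exact: IH.
Qed.

Lemma rintegrable_spow_mul r f g : 2 <= r ->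
  moment_finite r f -> moment_finite r g ->
  rintegrable (fun w => spow r (f w) * g w).
Proof.
move=> r2 [mf rf] [mg rg].
apply: rintegrable_le (rintegrableD rf rg) => [|w]; last exact: spow_mul_le.
by apply: measurable_funM => //; exact: measurableT_comp (measurable_spow r) mf.
Qed.

Definition moment_const r : R := 2 * powR_const r * expR (powR_const r).

Lemma moment_const_gt0 r : 0 <= r -> 0 < moment_const r.
Proof.
move=> r0; have := powR_const_ge1 r0.
by move=> h; rewrite !mulr_gt0 ?expR_gt0 //; lra.
Qed.

Lemma gronwall_sum (u b : nat -> R) (q c : R) n : 1 <= q -> 0 <= c ->
  u 0 = 0 -> (forall k, 0 <= b k) ->
  (forall k, (k < n)%N -> u k.+1 <= q * u k + c * b k) ->
  u n <= q ^+ n * (c * \sum_(j < n) b j).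
Proof.
move=> q1 c0 u0 b0; elim: n => [|n IH] rec.
  by rewrite u0 big_ord0 mulr0 mulr0.
apply: (le_trans (rec n (ltnSn n))).
have {}IH := IH (fun k kn => rec k (ltnW kn)).
rewrite big_ord_recr /= mulrDr mulrDr lerD //.
  by rewrite exprS -mulrA ler_wpM2l // (le_trans ler01).
rewrite -[leLHS]mul1r ler_wpM2r ?mulr_ge0 //.
exact: exprn_ege1.
Qed.

Lemma expr1Ddiv_le (K : R) n : 0 <= K -> (0 < n)%N ->
  (1 + K / n%:R) ^+ n <= expR K.
Proof.
move=> K0 n0; have nR : 0 < n%:R :> R by rewrite ltr0n.
have -> : expR K = expR (K / n%:R) ^+ n.
  by rewrite -expRM_natl mulrC divfK // gt_eqF.
rewrite lerXn2r ?nnegrE ?expR_ge0 ?expR_ge1Dx //.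
by rewrite addr_ge0 // divr_ge0 // ltW.
Qed.

(** Expanding [`|S_(k+1)| `^ r] to second order around the partial sum [S_k],
    the first-order term integrates to zero by orthogonality, and Young's
    inequality with the weight [n] turns the second-order term into a growth
    factor [1 + K / n].  Over [n] steps these factors multiply to at most
    [expR K]. *)
Lemma moment_sum_le r (n : nat) (D : nat -> Omega -> R) : 2 <= r -> (0 < n)%N ->
  (forall k, (k < n)%N -> moment_finite r (D k)) ->
  (forall k, (k < n)%N ->
     \int[mu]_w (spow r (\sum_(j < k) D j w) * D k w) = 0) ->
  \int[mu]_w (`|\sum_(j < n) D j w| `^ r) <=
  moment_const r * n%:R `^ (r / 2 - 1) * \sum_(j < n) \int[mu]_w (`|D j w| `^ r).
Proof.
move=> r2 n0 mD orth; have r0 : 0 < r by lra.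
have nR : 1 <= n%:R :> R by rewrite ler1n.
set K := powR_const r; have K1 : 1 <= K by apply: powR_const_ge1; exact: ltW.
set m := n%:R `^ (r / 2 - 1) : R.
have m1 : 1 <= m by rewrite -(@powRr0 R n%:R) ler_powR //; lra.
have mS k : (k <= n)%N -> moment_finite r (fun w => \sum_(j < k) D j w).
  move=> kn; apply: moment_finite_sum => // j _; apply: mD.
  exact: leq_trans (ltn_ord j) kn.
have step k : (k < n)%N ->
    \int[mu]_w (`|\sum_(j < k.+1) D j w| `^ r) <=
    (1 + K / n%:R) * \int[mu]_w (`|\sum_(j < k) D j w| `^ r)
    + 2 * K * m * \int[mu]_w (`|D k w| `^ r).
  move=> kn; have iS := (mS k (ltnW kn)).2; have iD := (mD k kn).2.
  have iSD := rintegrable_spow_mul r2 (mS k (ltnW kn)) (mD k kn).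
  pose S w := \sum_(j < k) D j w.
  have -> : (1 + K / n%:R) * \int[mu]_w (`|S w| `^ r)
    + 2 * K * m * \int[mu]_w (`|D k w| `^ r) =
    \int[mu]_w ((1 + K / n%:R) * (`|S w| `^ r) + 2 * K * m * (`|D k w| `^ r)
                + r * (spow r (S w) * D k w)).
    rewrite RintegralD //; last exact: rintegrableZ.
      rewrite [X in _ = _ + X]RintegralZl // orth // mulr0 addr0.
      by rewrite RintegralD //; [rewrite !RintegralZl // | |]; exact: rintegrableZ.
    by apply: rintegrableD; exact: rintegrableZ.
  apply: le_Rintegral => //.
  - exact: (mS k.+1 kn).2.
  - by do 2?apply: rintegrableD; exact: rintegrableZ.
  move=> w _; rewrite big_ord_recr /=.
  (* Young's inequality with weight n, the total number of steps, so that the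
     growth factor is the same at each step. *)
  apply: (le_trans (powR_add_le (S w) (D k w) r2)); rewrite -/K.
  have := powR_young r2 (normr_ge0 (S w)) (normr_ge0 (D k w)) nR.
  rewrite real_normK ?num_real // -/m => young.
  have d0 : 0 <= `|D k w| `^ r by exact: powR_ge0.
  set X := r * _; set s := `|S w| `^ r in young *.
  set dd := `|D k w| `^ r in young d0 *; set A := _ * D k w ^+ 2 in young *.
  have hKd : K * (A + dd) <= K * (s / n%:R + m * dd + m * dd).
    by apply: ler_wpM2l; [lra | nra].
  have -> : (1 + K / n%:R) * s + 2 * K * m * dd + X =
    s + X + K * (s / n%:R + m * dd + m * dd) by ring.
  by rewrite lerD2l.
have Km0 : 0 <= 2 * K * m by nra.
have q1 : 1 <= 1 + K / n%:R by rewrite lerDl divr_ge0 //; lra.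
have := @gronwall_sum (fun k => \int[mu]_w (`|\sum_(j < k) D j w| `^ r))
  (fun k => \int[mu]_w (`|D k w| `^ r)) (1 + K / n%:R) (2 * K * m) n q1 _ _ _ step.
move=> h; apply: le_trans (h _ _ _) _.
- exact: Km0.
- under eq_Rintegral do rewrite big_ord0 normr0 powR0 ?gt_eqF //.
  by rewrite Rintegral_cst // mul0r.
- by move=> k; apply: Rintegral_nneg => w; exact: powR_ge0.
have -> : moment_const r * m * \sum_(j < n) \int[mu]_w (`|D j w| `^ r) =
  expR K * (2 * K * m * \sum_(j < n) \int[mu]_w (`|D j w| `^ r)).
  by rewrite /moment_const -/K; ring.
apply: ler_wpM2r; last by apply: expr1Ddiv_le => //; exact: le_trans ler01 K1.
apply: mulr_ge0 => //; apply: sumr_ge0 => j _.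
by apply: Rintegral_nneg => w; exact: powR_ge0.
Qed.

End real_integrable.

(** * Orthogonality from sigma-algebras and from independence *)

Section orthogonality.
Context {d : measure_display} {Omega : measurableType d} {R : realType}.
Variable mu : {measure set Omega -> \bar R}.
Implicit Types (f g h : Omega -> R) (A : set Omega).

Lemma Rintegral_sum (I : Type) (s : seq I) (Q : pred I) (f : I -> Omega -> R) :
  (forall i, Q i -> rintegrable mu (f i)) ->
  rintegrable mu (fun w => \sum_(i <- s | Q i) f i w) /\
  \int[mu]_w (\sum_(i <- s | Q i) f i w) = \sum_(i <- s | Q i) \int[mu]_w f i w.
Proof.
move=> intf; elim: s => [|i s [IH1 IH2]].
  rewrite big_nil; under eq_fun do rewrite big_nil.
  split; first exact: rintegrable0.
  by rewrite Rintegral_cst // mul0r.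
rewrite big_cons; case: (boolP (Q i)) => [Qi|/negbTE Qi].
  under eq_fun do rewrite big_cons Qi.
  split; first exact: rintegrableD (intf _ Qi) IH1.
  by rewrite RintegralD ?IH2 //; exact: intf.
by under eq_fun do rewrite big_cons Qi.
Qed.

Lemma indic_mul_patch A f : (fun w => \1_A w * f w) = f \_ A.
Proof.
by apply/funext => w; rewrite patchE indicE; case: ifP; rewrite ?mul1r ?mul0r.
Qed.

Lemma Rintegral_indic_mul A f :
  \int[mu]_w (\1_A w * f w) = \int[mu]_(w in A) f w.
Proof. by rewrite [RHS]Rintegral_mkcond -indic_mul_patch. Qed.

Lemma rintegrable_indic_mul A f : measurable A -> rintegrable mu f ->
  rintegrable mu (fun w => \1_A w * f w).
Proof.
move=> mA intf; apply: rintegrable_le (integrable_norm intf).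
  apply: measurable_funM; last exact: rintegrable_measurable intf.
  exact: measurable_indic.
move=> w; rewrite /= indicE normrM.
by case: (w \in A); rewrite ?normr1 ?mul1r // normr0 mul0r.
Qed.

Section orthogonal_to_functions.
Variables h D : Omega -> R.
Hypotheses (mh : measurable_fun setT h) (iD : rintegrable mu D).
Hypothesis orth : forall B, measurable B -> \int[mu]_(w in h @^-1` B) D w = 0.

Let mpre B : measurable B -> measurable (h @^-1` B).
Proof. by move=> mB; rewrite -[X in measurable X]setTI; exact: mh. Qed.

Import HBNNSimple.

Lemma Rintegral_sfun_mul_eq0 (s : {nnsfun R >-> R}) :
  rintegrable mu (fun w => s (h w) * D w) /\ \int[mu]_w (s (h w) * D w) = 0.
Proof.
pose S : seq R := finmap.enum_fset (fset_set (range s)).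
pose F y w := y * (\1_(h @^-1` (s @^-1` [set y])) w * D w).
have iF y : true -> rintegrable mu (F y).
  move=> _; apply/rintegrableZ/rintegrable_indic_mul => //; exact/mpre.
have -> : (fun w => s (h w) * D w) = (fun w => \sum_(y <- S) F y w).
  apply/funext => w; rewrite [s (h w)]fimfunE fsbig_finite //= mulr_suml.
  by apply: eq_bigr => i _; rewrite /F -mulrA !indicE.
have [h1 h2] := Rintegral_sum S iF.
split; first exact: h1.
transitivity (\int[mu]_w (\sum_(y <- S) F y w)) => //.
rewrite h2 big1 // => y _; rewrite /F RintegralZl //; last first.
  by apply: rintegrable_indic_mul => //; exact/mpre.
by rewrite Rintegral_indic_mul orth ?mulr0.
Qed.

Lemma Rintegral_comp_mul_eq0 (f : R -> R) : measurable_fun setT f ->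
  (forall x, 0 <= f x) -> rintegrable mu (fun w => f (h w) * D w) ->
  \int[mu]_w (f (h w) * D w) = 0.
Proof.
move=> mf f0 ifD.
pose g := nnsfun_approx measurableT (proj2 (measurable_EFinP _ _) mf).
have f0' x : setT x -> (0 <= (EFin \o f) x)%E by rewrite lee_fin.
have gcvg x : EFin \o g^~ x @ \oo --> (EFin \o f) x.
  exact: (@cvg_nnsfun_approx _ _ _ _ measurableT _
            (proj2 (measurable_EFinP _ _) mf) f0' x).
have nd := nd_nnsfun_approx measurableT (proj2 (measurable_EFinP _ _) mf).
have gle n x : g n x <= f x.
  have ndx : nondecreasing_seq (EFin \o g^~ x).
    by move=> i j ij; rewrite lee_fin; move/lefP: (nd i j ij); apply.
  have := ereal_nondecreasing_cvgn ndx.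
  move/(cvg_unique (@ereal_hausdorff R))/(_ (gcvg x)) => e.
  by rewrite -lee_fin; move: e => /= <-; apply: ereal_sup_ubound; exists n.
have g0 n x : 0 <= g n x by exact: fun_ge0.
(* The approximating simple functions increase to f, so f (h w) * D w
   dominates. *)
have := @dominated_cvg _ _ _ mu _ measurableT
  (fun n w => (g n (h w) * D w)%:E) (fun w => (f (h w) * D w)%:E)
  (fun w => `|f (h w) * D w|%:E).
move=> /(_ _ _ _ _ _)/wrap [] //.
- move=> n; apply/measurable_EFinP/rintegrable_measurable.
  exact: (Rintegral_sfun_mul_eq0 (g n)).1.
- move=> w _; under eq_fun do rewrite EFinM.
  by rewrite EFinM; apply: cvgeZr => //; exact: gcvg.
- exact: integrable_norm ifD.
- move=> n w _; rewrite lee_fin !normrM (ger0_norm (g0 _ _)) (ger0_norm (f0 _)).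
  by rewrite ler_wpM2r.
move=> cv; rewrite /Rintegral.
have e n : (\int[mu]_w (g n (h w) * D w)%:E = 0)%E.
  have [i1 i2] := Rintegral_sfun_mul_eq0 (g n).
  by rewrite EFin_Rintegral // i2.
move: cv; under eq_fun do rewrite e.
by move/(cvg_unique (@ereal_hausdorff R))/(_ (cvg_cst _)) => ->.
Qed.

(** A function of [h] is a limit of combinations of indicators of sets
    [h @^-1` B], so orthogonality to the latter suffices. *)
Lemma Rintegral_mul_eq0 : rintegrable mu (fun w => h w * D w) ->
  \int[mu]_w (h w * D w) = 0.
Proof.
move=> ihD.
pose p (x : R) := Num.max x 0; pose q (x : R) := Num.max (- x) 0.
have pq x : x = p x - q x.
  by rewrite /p /q; case: (lerP x 0) => x0; case: (lerP (- x) 0) => x1; lra.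
have mp : measurable_fun setT p by exact: measurable_maxr.
have mq : measurable_fun setT q by apply: measurable_maxr.
have p0 x : 0 <= p x by rewrite le_max lexx orbT.
have q0 x : 0 <= q x by rewrite le_max lexx orbT.
have dom (f : R -> R) : measurable_fun setT f -> (forall x, `|f x| <= `|x|) ->
    rintegrable mu (fun w => f (h w) * D w).
  move=> mf fx; apply: rintegrable_le (integrable_norm ihD).
    apply: measurable_funM; first exact: measurableT_comp mf mh.
    exact: rintegrable_measurable iD.
  by move=> w; rewrite /= !normrM ler_wpM2r.
have ip : rintegrable mu (fun w => p (h w) * D w).
  apply: dom => // x; rewrite ger0_norm // /p.
  by case: (lerP x 0) => x0; [exact: normr_ge0|exact: ler_norm].
have iq : rintegrable mu (fun w => q (h w) * D w).
  apply: dom => // x; rewrite ger0_norm // /q.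
  case: (lerP (- x) 0) => x0; first exact: normr_ge0.
  by rewrite -normrN ler_norm.
under eq_Rintegral do rewrite [h _]pq mulrBl.
by rewrite RintegralB // !Rintegral_comp_mul_eq0 ?subrr.
Qed.

End orthogonal_to_functions.

(** The sets over which [f] has integral zero form a Dynkin system. *)
Lemma Rintegral_sigma_algebra_eq0 (G : set (set Omega)) f :
  setI_closed G -> G `<=` measurable -> rintegrable mu f ->
  \int[mu]_w f w = 0 -> (forall A, G A -> \int[mu]_(w in A) f w = 0) ->
  forall A, <<s G >> A -> \int[mu]_(w in A) f w = 0.
Proof.
move=> GI Gm intf f0 Gf A.
rewrite -setI_closed_g_dynkin_g_sigma_algebra // => dA.
have intS B : measurable B -> mu.-integrable B (EFin \o f).
  by move=> mB; apply: integrableS intf.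
pose H := [set B | measurable B /\ \int[mu]_(w in B) f w = 0].
suff : H A by case.
apply: (smallest_sub _ _ dA); last by move=> B GB; split; [exact: Gm|exact: Gf].
split.
- by split.
- move=> B [mB fB]; split; first exact: measurableC.
  have := @Rintegral_setU _ _ _ mu B (~` B) f mB (measurableC mB).
  rewrite setUv f0 fB add0r => <- //.
  by rewrite disj_set2E setICr.
- move=> F tF HF; have mF n : measurable (F n) by case: (HF n).
  have mU : measurable (\bigcup_k F k) by exact: bigcup_measurable.
  split=> //; rewrite /Rintegral integral_bigcup //; last exact: intS.
  rewrite eseries0 // => n _ _.
  have := integrable_fin_num (mF n) (intS _ (mF n)).
  by move=> /fineK <-; case: (HF n) => _; rewrite /Rintegral => ->.
Qed.

End orthogonality.

(** * Moments of sums of martingale differences and of independent variables *)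

Section moments_probability.
Context {d : measure_display} {Omega : measurableType d} {R : realType}.
Variable P : probability Omega R.
Implicit Types (f g : Omega -> R) (A : set Omega).

Lemma measurable_preimage (d' : measure_display) (E : measurableType d')
    (f : Omega -> E) (B : set E) :
  measurable_fun setT f -> measurable B -> measurable (f @^-1` B).
Proof. by move=> mf mB; rewrite -[X in measurable X]setTI; exact: mf. Qed.

Lemma rintegrable_cst (k : R) : rintegrable P (fun=> k).
Proof. exact: finite_measure_integrable_cst. Qed.

Lemma Rintegral_prob_cst (k : R) : \int[P]_w (fun=> k) w = k.
Proof.
rewrite Rintegral_cst // (_ : fine _ = 1) ?mulr1 //.
exact: (congr1 fine (@probability_setT _ _ _ P)).
Qed.

(** On a probability space moments of lower order are finite, since
    [`|x| `^ q <= 1 + `|x| `^ r] for [q <= r]. *)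
Lemma rintegrable_powR_le (q r : R) f : 0 <= q -> q <= r ->
  moment_finite P r f -> moment_finite P q f.
Proof.
move=> q0 qr [mf rf]; split => //.
apply: rintegrable_le (rintegrableD (rintegrable_cst 1) rf).
  exact: measurable_powR_norm.
move=> w; rewrite ger0_norm ?powR_ge0 //.
have [h|h] := lerP `|f w| 1.
  rewrite -[leLHS]addr0 lerD ?powR_ge0 //.
  have <- : 1 `^ q = 1 :> R by rewrite powR1.
  by apply: ge0_ler_powR; rewrite ?nnegrE.
by rewrite -[leLHS]add0r lerD // ler_powR // ltW.
Qed.

Lemma moment_finite_rintegrable (r : R) f : 1 <= r ->
  moment_finite P r f -> rintegrable P f.
Proof.
move=> r1 rf; have [mf h] := rintegrable_powR_le ler01 r1 rf.
apply: rintegrable_le mf _ h => w.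
by rewrite powRr1.
Qed.

Lemma Rintegral_indic_prob A : measurable A -> \int[P]_w \1_A w = fine (P A).
Proof. by move=> mA; rewrite /Rintegral integral_indic // setIT. Qed.

(** By independence [\1_A - P A] is orthogonal to the events carried by [f],
    hence to [f] itself. *)
Lemma Rintegral_indep_set A f : measurable A -> rintegrable P f ->
  (forall C, measurable C -> P (A `&` f @^-1` C) = (P A * P (f @^-1` C))%E) ->
  \int[P]_(w in A) f w = fine (P A) * \int[P]_w f w.
Proof.
move=> mA intf ind; have mf := rintegrable_measurable intf.
pose D w := \1_A w - fine (P A).
have mI : measurable_fun setT (\1_A : Omega -> R) by exact: measurable_indic.
have iI : rintegrable P (\1_A : Omega -> R).
  by apply: rintegrable_le (rintegrable_cst 1) => // w; rewrite indicE normr_nat lern1 leq_b1.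
have iD : rintegrable P D by apply: rintegrableB => //; exact: rintegrable_cst.
have orth B : measurable B -> \int[P]_(w in f @^-1` B) D w = 0.
  move=> mB; have mfB := measurable_preimage mf mB.
  have iS g : rintegrable P g -> P.-integrable (f @^-1` B) (EFin \o g).
    by move=> ig; apply: integrableS ig.
  rewrite RintegralB //; [|exact: iS|exact: iS (rintegrable_cst _)].
  have -> : \int[P]_(w in f @^-1` B) \1_A w = fine (P A * P (f @^-1` B))%E.
    by rewrite /Rintegral integral_indic //; congr fine; exact: ind.
  by rewrite Rintegral_cst // fineM ?fin_num_measure // subrr.
have iAf : rintegrable P (fun w => \1_A w * f w) by exact: rintegrable_indic_mul.
have ifD : rintegrable P (fun w => f w * D w).
  have := rintegrableB iAf (rintegrableZ (fine (P A)) intf).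
  apply: eq_integrable => // w _ /=; congr EFin; rewrite /D; ring.
have := Rintegral_mul_eq0 mf iD orth ifD.
have -> : \int[P]_w (f w * D w) =
    \int[P]_w (\1_A w * f w - fine (P A) * f w).
  by apply: eq_Rintegral => w _; rewrite /D; ring.
rewrite RintegralB //; last exact: rintegrableZ.
rewrite RintegralZl // Rintegral_indic_mul.
by move/eqP; rewrite subr_eq0 => /eqP.
Qed.

Section filtration.
Variables (n : nat) (e : 'I_n -> Omega -> R).

Let gen (k : nat) : set (set Omega) :=
  \bigcup_(s in [set s : 'I_n | (s < k)%N]) preimage_set_system setT (e s) measurable.

(** The generated sigma-algebra is used as the measurable structure of the
    domain, for which the generators [e s] are measurable. *)
Lemma natural_filtration_sum_preimage k (a : 'I_n -> R) (f : R -> R) (B : set R) :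
  measurable_fun setT f -> measurable B ->
  natural_filtration e k
    ((fun w => f (\sum_(s < n | (s < k)%N) a s * e s w)) @^-1` B).
Proof.
move=> mf mB.
pose S (w : g_sigma_algebraType (gen k)) : R :=
  f (\sum_(s < n) (if (s < k)%N then a s * e s w else 0)).
have mS : measurable_fun setT S.
  apply: (measurableT_comp mf); apply: measurable_sum => s.
  case sk: (s < k)%N; last exact: measurable_cst.
  apply: measurable_funM => //.
  move=> _ C mC; apply: sub_sigma_algebra.
  by exists s => //; exists C.
have -> : (fun w => f (\sum_(s < n | (s < k)%N) a s * e s w)) = S.
  by apply/funext => w; rewrite /S -big_mkcond.
by have := mS measurableT B mB; rewrite setTI.
Qed.

(** The partial sums before [k] are measurable for the past of [e k], to which
    [e k] is orthogonal. *)
Lemma moment_martingale_le (r : R) (a : 'I_n -> R) : 2 <= r -> (0 < n)%N ->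
  (forall k, moment_finite P r (e k)) ->
  (forall (k : 'I_n) A, natural_filtration e k A -> \int[P]_(w in A) e k w = 0) ->
  \int[P]_w (`|\sum_(k < n) a k * e k w| `^ r) <=
  moment_const r * n%:R `^ (r / 2 - 1) *
    \sum_(k < n) `|a k| `^ r * \int[P]_w (`|e k w| `^ r).
Proof.
move=> r2 n0 re mart; have r1 : 1 <= r by lra.
have me k : measurable_fun setT (e k) by case: (re k).
(* Increments indexed by all natural numbers, zero from n on. *)
pose D j w := if insub j is Some i then a i * e i w else 0.
have DE (i : 'I_n) : D i = (fun w => a i * e i w).
  by apply/funext => w; rewrite /D valK.
have sumD k w : (k <= n)%N ->
    \sum_(j < k) D j w = \sum_(j < n | (j < k)%N) a j * e j w.
  move=> kn; rewrite (big_ord_widen _ (fun j => D j w) kn).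
  by apply: eq_bigr => j _; rewrite DE.
have rD k : (k < n)%N -> moment_finite P r (D k).
  by move=> kn; rewrite (DE (Ordinal kn)); exact: moment_finiteZ.
have -> : \int[P]_w (`|\sum_(k < n) a k * e k w| `^ r) =
    \int[P]_w (`|\sum_(k < n) D k w| `^ r).
  by apply: eq_Rintegral => w _; under [in RHS]eq_bigr do rewrite DE.
have -> : \sum_(k < n) `|a k| `^ r * \int[P]_w (`|e k w| `^ r) =
    \sum_(k < n) \int[P]_w (`|D k w| `^ r).
  apply: eq_bigr => k _; rewrite -RintegralZl //; last by case: (re k).
  by apply: eq_Rintegral => w _; rewrite DE normrM powRM.
apply: moment_sum_le => // k kn; pose i := Ordinal kn.
have -> : \int[P]_w (spow r (\sum_(j < k) D j w) * D k w) =
    a i * \int[P]_w (spow r (\sum_(j < n | (j < k)%N) a j * e j w) * e i w).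
  rewrite -RintegralZl //.
    by apply: eq_Rintegral => w _; rewrite sumD ?(DE i) 1?ltnW //; ring.
  apply: rintegrable_spow_mul => //; apply: moment_finite_sum => [|j _]; first lra.
  exact: moment_finiteZ.
have mS : moment_finite P r (fun w => \sum_(j < n | (j < k)%N) a j * e j w).
  by apply: moment_finite_sum => [|j _]; [lra|exact: moment_finiteZ].
rewrite Rintegral_mul_eq0 ?mulr0 //.
- by apply: (measurableT_comp (measurable_spow r)); case: mS.
- exact: moment_finite_rintegrable (re i).
- move=> B mB; apply: mart.
  exact: natural_filtration_sum_preimage (measurable_spow r) mB.
- exact: rintegrable_spow_mul.
Qed.

End filtration.

Lemma mutually_independent_comp (I : finType) (d1 d2 : measure_display)
    (E1 : measurableType d1) (E2 : measurableType d2) (f : I -> Omega -> E1)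
    (g : I -> E1 -> E2) : (forall i, measurable_fun setT (g i)) ->
  mutually_independent P f -> mutually_independent P (fun i => g i \o f i).
Proof.
move=> mg ind J B mB; have := ind J (fun i => g i @^-1` B i).
by apply => i; rewrite -[X in measurable X]setTI; exact: mg.
Qed.

(** The intersections of events carried by single past variables form a
    pi-system generating the past, and are independent of the present. *)
Lemma independent_martingale (n : nat) (W : 'I_n -> Omega -> R) :
  mutually_independent P W -> (forall i, rintegrable P (W i)) ->
  (forall i, \int[P]_w W i w = 0) ->
  forall (k : 'I_n) A, natural_filtration W k A -> \int[P]_(w in A) W k w = 0.
Proof.
move=> ind iW cW k A.
have mW i := rintegrable_measurable (iW i).
pose J : {set 'I_n} := [set s : 'I_n | (s < k)%N]%SET.
pose G := [set C : set Omega | exists B : 'I_n -> set R,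
  (forall i, measurable (B i)) /\ C = \bigcap_(i in [set` J]) W i @^-1` B i].
have GI : setI_closed G.
  move=> _ _ [B1 [mB1 ->]] [B2 [mB2 ->]].
  exists (fun i => B1 i `&` B2 i); split; first by move=> i; exact: measurableI.
  by rewrite -bigcapI.
have Gm : G `<=` measurable.
  move=> _ [B [mB ->]]; apply: fin_bigcap_measurable => // i _.
  exact: measurable_preimage.
have Gindep C : G C -> \int[P]_(w in C) W k w = 0.
  move=> GC; rewrite Rintegral_indep_set ?cW ?mulr0 //; first exact: Gm.
  case: GC => B [mB ->] S mS.
  have kJ : k \notin J by rewrite inE ltnn.
  pose B' i := if i == k then S else B i.
  have mB' i : measurable (B' i) by rewrite /B'; case: ifP.
  have B'E i : i \in J -> B' i = B i.
    by move=> iJ; rewrite /B'; case: eqP => // ik; rewrite -ik iJ in kJ.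
  have -> : (\bigcap_(i in [set` J]) W i @^-1` B i) `&` W k @^-1` S =
      \bigcap_(i in [set` (k |: J)%SET]) W i @^-1` B' i.
    apply/seteqP; split=> w /=.
      move=> [h hk] i /=; rewrite in_setU1 => /orP[/eqP ->|iJ].
        by rewrite /B' eqxx.
      by rewrite B'E //; exact: h.
    move=> h; split; last by have := h k; rewrite /= setU11 /B' eqxx; exact.
    by move=> i /= iJ; have := h i; rewrite /= in_setU1 iJ orbT B'E //; exact.
  rewrite (ind _ _ mB') (ind _ _ mB) big_setU1 //= /B' eqxx muleC; congr (_ * _)%E.
  by apply: eq_bigr => i iJ; have := B'E i iJ; rewrite /B' => ->.
move=> FA; apply: (Rintegral_sigma_algebra_eq0 GI Gm (iW k) (cW k) Gindep).
move: FA; apply: smallest_sub; first exact: smallest_sigma_algebra.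
move=> _ [s /= sk [B mB <-]]; apply: sub_sigma_algebra.
exists (fun i => if i == s then B else setT); split; first by move=> i; case: ifP.
rewrite setTI; apply/seteqP; split=> w /=.
  by move=> Bw i _; case: eqP => // ->.
by move=> /(_ s); rewrite /= inE eqxx; exact.
Qed.

Lemma moment_independent_le (r : R) (n : nat) (W : 'I_n -> Omega -> R) :
  2 <= r -> (0 < n)%N -> mutually_independent P W ->
  (forall i, moment_finite P r (W i)) -> (forall i, \int[P]_w W i w = 0) ->
  \int[P]_w (`|\sum_(i < n) W i w| `^ r) <=
  moment_const r * n%:R `^ (r / 2 - 1) * \sum_(i < n) \int[P]_w (`|W i w| `^ r).
Proof.
move=> r2 n0 ind mW cW.
have iW i : rintegrable P (W i) by apply: moment_finite_rintegrable (mW i); lra.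
have := @moment_martingale_le n W r (fun=> 1) r2 n0 mW
  (independent_martingale ind iW cW).
under eq_Rintegral do under eq_bigr do rewrite mul1r.
by under [X in _ <= _ * X]eq_bigr do rewrite normr1 powR1 mul1r.
Qed.

Section independent_pair.
Context {d1 d2 : measure_display} {E1 : measurableType d1}
  {E2 : measurableType d2}.
Variables (X : Omega -> E1) (Y : Omega -> E2).
Hypotheses (mX : measurable_fun setT X) (mY : measurable_fun setT Y).
Hypothesis XY : independent P X Y.

Let X' : {mfun Omega >-> E1} := HB.pack X (isMeasurableFun.Build _ _ _ _ _ mX).
Let Y' : {mfun Omega >-> E2} := HB.pack Y (isMeasurableFun.Build _ _ _ _ _ mY).

Let Z w := (X w, Y w).
Let mZ : measurable_fun setT Z.
Proof. exact/measurable_fun_pairP. Qed.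
Let Z' : {mfun Omega >-> (E1 * E2)%type} :=
  HB.pack Z (isMeasurableFun.Build _ _ _ _ _ mZ).

(** The joint law of an independent pair is the product of the laws, so the
    left-hand side is a double integral by Tonelli's theorem. *)
Lemma ge0_integral_independent (h : E1 * E2 -> \bar R) :
  measurable_fun setT h -> (forall z, (0 <= h z)%E) ->
  (\int[P]_w h (X w, Y w) = \int[P]_v \int[P]_w h (X v, Y w))%E.
Proof.
move=> mh h0.
transitivity (\int[distribution P Z']_z h z)%E.
  by rewrite ge0_integral_distribution.
transitivity (\int[distribution P X' \x distribution P Y']_z h z)%E.
  apply: eq_measure_integral => A mA _; apply/esym.
  exact: product_measure_unique.
rewrite fubini_tonelli1 // ge0_integral_distribution //; first last.
- by move=> x; apply: integral_ge0.
- exact: measurable_fun_fubini_tonelli_F.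
apply: eq_integral => v _; rewrite /= /fubini_F ge0_integral_distribution //.
by apply: measurableT_comp mh _; exact: pair1_measurable.
Qed.

Lemma measurable_integral_independent (h : E1 * E2 -> \bar R) :
  measurable_fun setT h -> (forall z, (0 <= h z)%E) ->
  measurable_fun setT (fun v => \int[P]_w h (X v, Y w))%E.
Proof.
move=> mh h0.
have -> : (fun v => \int[P]_w h (X v, Y w))%E = fubini_F (distribution P Y') h \o X.
  apply/funext => v; rewrite /= /fubini_F ge0_integral_distribution //.
  by apply: measurableT_comp mh _; exact: pair1_measurable.
by apply: measurableT_comp mX; exact: measurable_fun_fubini_tonelli_F.
Qed.

End independent_pair.

Lemma Rintegral_indep_mul f g : independent P f g -> rintegrable P g ->
  measurable_fun setT f -> rintegrable P (fun w => f w * g w) ->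
  \int[P]_w g w = 0 -> \int[P]_w (f w * g w) = 0.
Proof.
move=> ind ig mf ifg g0; apply: Rintegral_mul_eq0 => // B mB.
rewrite Rintegral_indep_set ?g0 ?mulr0 //; first exact: measurable_preimage.
by move=> C mC; exact: ind.
Qed.

End moments_probability.

(** * Norms, quadratic forms and restricted eigenvalues *)

Section norm_lemmas.
Context {R : realType}.

Lemma l2norm_ge0 n (v : 'cV[R]_n) : 0 <= l2norm v.
Proof. exact: sqrtr_ge0. Qed.

Lemma sqr_l2norm n (v : 'cV[R]_n) : l2norm v ^+ 2 = \sum_i v i 0 ^+ 2.
Proof. by rewrite sqr_sqrtr // sumr_ge0 // => i _; exact: sqr_ge0. Qed.

Lemma sqr_l2norm_mx n (v : 'cV[R]_n) : l2norm v ^+ 2 = (v^T *m v) 0 0.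
Proof.
by rewrite sqr_l2norm mxE; apply: eq_bigr => i _; rewrite mxE expr2.
Qed.

Lemma l2norm_eq0 n (v : 'cV[R]_n) : l2norm v = 0 -> v = 0.
Proof.
move=> v0; apply/colP => i; rewrite mxE; apply/eqP; rewrite -sqrf_eq0.
have : \sum_i v i 0 ^+ 2 == 0 by rewrite -sqr_l2norm v0 expr0n.
by rewrite psumr_eq0 => [/allP/(_ i)|j _]; [apply; rewrite mem_index_enum|exact: sqr_ge0].
Qed.

Lemma l2norm_gt0 n (v : 'cV[R]_n) : v != 0 -> 0 < l2norm v.
Proof.
move=> v0; rewrite lt_neqAle l2norm_ge0 andbT eq_sym.
by apply: contra v0 => /eqP/l2norm_eq0 ->.
Qed.

Lemma l2normZ n k (v : 'cV[R]_n) : 0 <= k -> l2norm (k *: v) = k * l2norm v.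
Proof.
move=> k0; rewrite /l2norm.
under eq_bigr do rewrite mxE exprMn.
by rewrite -mulr_sumr sqrtrM ?sqr_ge0 // sqrtr_sqr ger0_norm.
Qed.

Lemma sqr_l2norm_col_mx m n (u : 'cV[R]_m) (v : 'cV[R]_n) :
  l2norm (col_mx u v) ^+ 2 = l2norm u ^+ 2 + l2norm v ^+ 2.
Proof.
rewrite !sqr_l2norm big_split_ord /=.
by congr (_ + _); apply: eq_bigr => i _; rewrite ?col_mxEu ?col_mxEd.
Qed.

Lemma l2norm_col_mx_geu m n (u : 'cV[R]_m) (v : 'cV[R]_n) :
  l2norm u <= l2norm (col_mx u v).
Proof.
rewrite -ler_sqr ?nnegrE ?l2norm_ge0 // sqr_l2norm_col_mx lerDl.
exact: sqr_ge0.
Qed.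

Lemma l2norm_col_mx_ged m n (u : 'cV[R]_m) (v : 'cV[R]_n) :
  l2norm v <= l2norm (col_mx u v).
Proof.
rewrite -ler_sqr ?nnegrE ?l2norm_ge0 // sqr_l2norm_col_mx lerDr.
exact: sqr_ge0.
Qed.

Lemma l1norm_on_ge0 n (A : {set 'I_n}) (v : 'cV[R]_n) : 0 <= l1norm_on A v.
Proof. by apply: sumr_ge0. Qed.

Lemma l1norm_ge0 n (v : 'cV[R]_n) : 0 <= l1norm v.
Proof. by apply: sumr_ge0. Qed.

Lemma l1norm_onC n (A : {set 'I_n}) (v : 'cV[R]_n) :
  l1norm v = l1norm_on A v + l1norm_on (~: A)%SET v.
Proof.
rewrite /l1norm (bigID (mem A)) /=; congr (_ + _).
by apply: eq_bigl => i; rewrite inE.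
Qed.

Lemma l1norm_onZ n (A : {set 'I_n}) k (v : 'cV[R]_n) :
  l1norm_on A (k *: v) = `|k| * l1norm_on A v.
Proof. by rewrite mulr_sumr; apply: eq_bigr => i _; rewrite mxE normrM. Qed.

Lemma l1norm_on_le_l2norm n (A : {set 'I_n}) (v : 'cV[R]_n) :
  l1norm_on A v <= Num.sqrt #|A|%:R * l2norm v.
Proof.
rewrite -ler_sqr ?nnegrE ?mulr_ge0 ?sqrtr_ge0 ?l1norm_on_ge0 // exprMn.
rewrite sqr_sqrtr // sqr_l2norm.
have [A0|A0] := eqVneq #|A| 0%N.
  rewrite A0 mul0r (cards0_eq A0) /l1norm_on big_set0 expr0n //.
have k0 : 0 < #|A|%:R :> R by rewrite ltr0n lt0n.
set k := #|A|%:R : R in k0 *; set s := l1norm_on A v.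
(* Cauchy-Schwarz, as nonnegativity of the variance over A. *)
have : 0 <= \sum_(i in A) (`|v i 0| - s / k) ^+ 2.
  by apply: sumr_ge0 => i _; exact: sqr_ge0.
have -> : \sum_(i in A) (`|v i 0| - s / k) ^+ 2 =
    \sum_(i in A) v i 0 ^+ 2 - s ^+ 2 / k.
  have e i : (`|v i 0| - s / k) ^+ 2 =
      v i 0 ^+ 2 - (2 * (s / k) * `|v i 0| - (s / k) ^+ 2).
    by rewrite -[in RHS](real_normK (num_real (v i 0))); ring.
  under eq_bigr do rewrite e.
  rewrite big_split /= sumrN big_split /= -mulr_sumr -/(l1norm_on A v) -/s.
  rewrite sumrN sumr_const -[_ *+ #|A|]mulr_natl -/k; congr (_ - _).
  by field; rewrite gt_eqF.
have le : \sum_(i in A) v i 0 ^+ 2 <= \sum_i v i 0 ^+ 2.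
  rewrite [leRHS](bigID (mem A)) /= lerDl.
  by apply: sumr_ge0 => i _; exact: sqr_ge0.
rewrite subr_ge0 ler_pdivrMr // => /le_trans; apply.
by rewrite mulrC ler_wpM2l // ltW.
Qed.

Lemma linfnorm_ge n (v : 'cV[R]_n) i : `|v i 0| <= linfnorm v.
Proof. exact: (@le_bigmax _ _ _ 0 (fun i => `|v i 0|) i). Qed.

Lemma linfnorm_le n (v : 'cV[R]_n) k :
  0 <= k -> (linfnorm v <= k) = [forall i, `|v i 0| <= k].
Proof.
move=> k0; apply/idP/forallP => [h i|h].
  exact: le_trans (linfnorm_ge _ _) h.
by apply: bigmax_le.
Qed.

Lemma dot_le_linf_l1 n (u v : 'cV[R]_n) :
  `|(u^T *m v) 0 0| <= linfnorm u * l1norm v.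
Proof.
rewrite mxE mulr_sumr; apply: le_trans (ler_norm_sum _ _ _) _.
apply: ler_sum => i _; rewrite mxE normrM ler_wpM2r //.
exact: linfnorm_ge.
Qed.

(** An entrywise perturbation moves a quadratic form by at most the
    perturbation times the squared l1-norm. *)
Lemma quad_form_le n (M : 'M[R]_n) (v : 'cV[R]_n) k :
  (forall i j, `|M i j| <= k) -> `|(v^T *m M *m v) 0 0| <= k * l1norm v ^+ 2.
Proof.
move=> Mk; rewrite -mulmxA mxE; apply: le_trans (ler_norm_sum _ _ _) _.
rewrite expr2 mulrA [k * _]mulrC -mulrA mulr_suml.
apply: ler_sum => i _; rewrite !mxE normrM ler_wpM2l // mulr_sumr.
apply: le_trans (ler_norm_sum _ _ _) _.
by apply: ler_sum => j _; rewrite normrM ler_wpM2r.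
Qed.

End norm_lemmas.

Section restricted_eigenvalue.
Context {R : realType} {N T p : nat}.
Variables (lam mu : R).
Implicit Types (M : 'M[R]_(p + N)) (v : 'cV[R]_(p + N)).

Local Notation cone := (@restricted_cone R N T p lam mu).

Lemma kappa2_geP M s1 s2 (K : R) : reflect
  (forall v, cone s1 s2 v -> K * l2norm v ^+ 2 <= (v^T *m M *m v) 0 0)
  (K%:E <= kappa2 T lam mu M s1 s2)%E.
Proof.
apply: (iffP idP) => [h v cv|h].
  have v0 : 0 < l2norm v ^+ 2 by rewrite exprn_gt0 // l2norm_gt0; case: cv.
  rewrite -ler_pdivlMr // -lee_fin; apply: le_trans h _.
  by apply: ereal_inf_lbound; exists v.
apply: le_ereal_inf_tmp => x [v cv <-].
have v0 : 0 < l2norm v ^+ 2 by rewrite exprn_gt0 // l2norm_gt0; case: cv.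
by rewrite lee_fin ler_pdivlMr //; exact: h.
Qed.

Lemma kappa2_le M s1 s2 v : cone s1 s2 v ->
  (kappa2 T lam mu M s1 s2 <= ((v^T *m M *m v) 0 0 / l2norm v ^+ 2)%:E)%E.
Proof. by move=> cv; apply: ereal_inf_lbound; exists v. Qed.

Lemma kappa2_set0 M s1 s2 : (forall v, ~ cone s1 s2 v) ->
  kappa2 T lam mu M s1 s2 = +oo%E.
Proof.
move=> c0; rewrite /kappa2 (_ : [set _ | _ in _] = set0) ?ereal_inf0 //.
by apply/seteqP; split=> // x [v /c0].
Qed.

End restricted_eigenvalue.

(** * The design matrices *)

Section design_lemmas.
Context {R : realType} {N T p : nat}.
Local Notation NT := (\sum_(i < N) T)%N.

Lemma stack_tr_mul m n (A : 'I_N -> 'M[R]_(T, m)) (B : 'I_N -> 'M[R]_(T, n)) :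
  (stack A)^T *m stack B = \sum_i (A i)^T *m B i.
Proof. by rewrite tr_mxcol mul_mxrow_mxcol. Qed.

Let dblock (i : 'I_N) : 'M[R]_(T, N) :=
  (const_mx 1 : 'cV[R]_T) *m (delta_mx 0 i : 'rV[R]_N).

Lemma dblockE i t j : dblock i t j = (i == j)%:R.
Proof.
rewrite /dblock mxE big_ord1 !mxE mul1r eqxx /=.
by rewrite eq_sym.
Qed.

Lemma dummies_tr_stackE n (B : 'I_N -> 'M[R]_(T, n)) i j :
  ((dummies R N T)^T *m stack B) i j = \sum_t B i t j.
Proof.
rewrite stack_tr_mul summxE (bigD1 i) //= [X in _ + X]big1 ?addr0.
  by rewrite mxE; apply: eq_bigr => t _; rewrite mxE dblockE eqxx mul1r.
move=> i' /negbTE ii'; rewrite mxE big1 // => t _.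
by rewrite mxE dblockE ii' mul0r.
Qed.

Lemma dummies_tr_dummies :
  (dummies R N T)^T *m dummies R N T = (T%:R : R)%:M.
Proof.
apply/matrixP => i j; rewrite dummies_tr_stackE !mxE.
under eq_bigr do rewrite dblockE.
by rewrite sumr_const card_ord; case: (i == j); rewrite ?mulr1n ?mul0rn.
Qed.

Lemma dummies_mul (c : 'cV[R]_N) :
  dummies R N T *m c = stack (fun i => const_mx (c i 0)).
Proof.
rewrite /dummies /stack mxcol_mul; apply: eq_mxcol => i.
apply/matrixP => t j; rewrite mxE (bigD1 i) //= big1 ?addr0.
  by rewrite dblockE eqxx mul1r mxE ord1.
by move=> k /negbTE ki; rewrite dblockE eq_sym ki mul0r.
Qed.

Definition scaling_inv : 'M[R]_(p + N) :=
  block_mx ((Num.sqrt (N%:R * T%:R))^-1)%:M 0 0 ((Num.sqrt T%:R)^-1)%:M.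

Hypotheses (N_gt0 : (0 < N)%N) (T_gt0 : (0 < T)%N).

Lemma sqrtT_neq0 : Num.sqrt (T%:R : R) != 0.
Proof. by rewrite gt_eqF // sqrtr_gt0 ltr0n. Qed.

Lemma sqrtNT_neq0 : Num.sqrt (N%:R * T%:R : R) != 0.
Proof. by rewrite gt_eqF // sqrtr_gt0 mulr_gt0 ?ltr0n. Qed.

Lemma scaling_invK : (@scaling R N T p) *m scaling_inv = 1%:M.
Proof.
rewrite mulmx_block !mul0mx !mulmx0 !addr0 !add0r -!scalar_mxM.
by rewrite !divff ?sqrtT_neq0 ?sqrtNT_neq0 // -scalar_mx_block.
Qed.

Lemma invmx_scaling : invmx (@scaling R N T p) = scaling_inv.
Proof.
have [u _] := mulmx1_unit scaling_invK.
by rewrite -[LHS]mulmx1 -scaling_invK mulmxA mulVmx // mul1mx.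
Qed.

Lemma Psi_block (X : 'M[R]_(NT, p)) :
  Psi X = block_mx
    ((N%:R * T%:R)^-1 *: (X^T *m X))
    ((Num.sqrt (N%:R * T%:R) * Num.sqrt T%:R)^-1 *: (X^T *m dummies R N T))
    ((Num.sqrt (N%:R * T%:R) * Num.sqrt T%:R)^-1 *: (X^T *m dummies R N T)^T)
    1%:M.
Proof.
have T0 : 0 <= T%:R :> R by [].
have NT0 : 0 <= N%:R * T%:R :> R by rewrite mulr_ge0.
have nT : T%:R != 0 :> R by rewrite pnatr_eq0 -lt0n.
rewrite /Psi invmx_scaling tr_row_mx mul_col_row /scaling_inv.
rewrite !mulmx_block !mul0mx !mulmx0 !addr0 !add0r.
rewrite !mul_scalar_mx !mul_mx_scalar !scalerA.
rewrite dummies_tr_dummies trmx_mul trmxK.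
congr block_mx.
- by rewrite -invfM -expr2 sqr_sqrtr.
- by rewrite invfM mulrC.
- by rewrite invfM mulrC.
rewrite scale_scalar_mx; congr (_%:M).
rewrite -[X in _ * X = _](sqr_sqrtr T0); field; exact: sqrtT_neq0.
Qed.

(** The scaling of the vector cancels the one inside [Psi]. *)
Lemma Psi_quad (X : 'M[R]_(NT, p)) (u : 'cV[R]_p) (v : 'cV[R]_N) :
  let w := col_mx (Num.sqrt (N%:R * T%:R) *: u) (Num.sqrt T%:R *: v) in
  (w^T *m Psi X *m w) 0 0 =
  l2norm (row_mx X (dummies R N T) *m col_mx u v) ^+ 2.
Proof.
move=> w; rewrite /Psi invmx_scaling.
have e : scaling_inv *m w = col_mx u v.
  rewrite mul_block_col !mul0mx addr0 add0r !mul_scalar_mx !scalerA.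
  by rewrite !mulVf ?sqrtT_neq0 ?sqrtNT_neq0 // !scale1r.
have st : scaling_inv^T = scaling_inv.
  by rewrite tr_block_mx !tr_scalar_mx !trmx0.
have e' : w^T *m scaling_inv = (col_mx u v)^T by rewrite -e trmx_mul st.
by rewrite sqr_l2norm_mx trmx_mul !mulmxA e' -!mulmxA e.
Qed.

End design_lemmas.

(** * The Lasso inequality and the geometry of the cone *)

(** [sparsity] counts a classical set, whereas the cone quantifies over finite
    sets. *)
Lemma sparsityE (R : realType) n (b : 'cV[R]_n) :
  sparsity b = #|[set i | b i 0 != 0]%SET|.
Proof.
apply: eq_card => i; rewrite [RHS]inE.
by apply/idP/idP => [/set_mem|h]; [|apply/mem_set].
Qed.

Section lasso.
Context {R : realType} {N T p : nat}.
Hypotheses (N_gt0 : (0 < N)%N) (T_gt0 : (0 < T)%N).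
Local Notation NT := (\sum_(i < N) T)%N.
Variables (X : 'M[R]_(NT, p)) (e y : 'cV[R]_NT) (lam mu : R).
Variables (beta bhat : 'cV[R]_p) (c chat : 'cV[R]_N).

Local Notation D := (dummies R N T).
Local Notation Z := (row_mx X D).
Local Notation u := (bhat - beta).
Local Notation v := (chat - c).
Local Notation J1 := [set i | beta i 0 != 0]%SET.
Local Notation J2 := [set i | c i 0 != 0]%SET.
Local Notation w :=
  (col_mx (Num.sqrt (N%:R * T%:R) *: u) (Num.sqrt T%:R *: v)).
Local Notation L1 := (lam / Num.sqrt (N%:R * T%:R)).
Local Notation L2 := (mu / Num.sqrt T%:R).

Lemma l1norm_support_le n (b b' : 'cV[R]_n) :
  l1norm b - l1norm b' <= l1norm_on [set i | b i 0 != 0]%SET (b' - b)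
                          - l1norm_on (~: [set i | b i 0 != 0])%SET (b' - b).
Proof.
set J := [set i | _]%SET.
rewrite !(l1norm_onC J) opprD addrACA; apply: lerD.
  rewrite -sumrB; apply: ler_sum => i _; rewrite !mxE distrC.
  exact: lerB_dist.
rewrite -sumrB -sumrN; apply: ler_sum => i; rewrite !inE negbK => /eqP b0.
by rewrite !mxE b0 normr0 subr0 sub0r.
Qed.

Hypotheses (lam_ge0 : 0 <= lam) (mu_ge0 : 0 <= mu).
Hypotheses (Xe : linfnorm (X^T *m e) <= lam / 2).
Hypotheses (De : linfnorm (D^T *m e) <= mu / 2).
Hypothesis yE : y = Z *m col_mx beta c + e.
Hypothesis lasso : is_panel_lasso X y lam mu bhat chat.

(** Comparing the objective at the estimator and at the true parameter: the
    noise is absorbed by one half of the penalty, and the other half controls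
    the error off the support. *)
Lemma lasso_basic :
  l2norm (Z *m col_mx u v) ^+ 2
    + (lam * l1norm_on (~: J1)%SET u + mu * l1norm_on (~: J2)%SET v)
  <= 3 * lam * l1norm_on J1 u + 3 * mu * l1norm_on J2 v.
Proof.
have := lasso beta c; rewrite /lasso_objective.
set f := Z *m col_mx u v.
have -> : y - Z *m col_mx bhat chat = e - f.
  have -> : f = Z *m col_mx bhat chat - Z *m col_mx beta c.
    by rewrite -mulmxBr opp_col_mx add_col_mx.
  by rewrite yE opprB addrA (addrC e).
have -> : y - Z *m col_mx beta c = e by rewrite yE addrC addKr.
have -> : l2norm (e - f) ^+ 2 = l2norm e ^+ 2 - 2 * (e^T *m f) 0 0 + l2norm f ^+ 2.
  rewrite !sqr_l2norm mxE mulr_sumr -sumrB -big_split /=.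
  by apply: eq_bigr => i _; rewrite !mxE; ring.
have ef : 2 * (e^T *m f) 0 0 <= lam * l1norm u + mu * l1norm v.
  have -> : e^T *m f = (X^T *m e)^T *m u + (D^T *m e)^T *m v.
    by rewrite /f mul_row_col mulmxDr !trmx_mul !trmxK !mulmxA.
  rewrite mxE mulrDr; apply: lerD.
    have := le_trans (ler_norm _) (dot_le_linf_l1 (X^T *m e) u).
    have := l1norm_ge0 u; move: Xe; nra.
  have := le_trans (ler_norm _) (dot_le_linf_l1 (D^T *m e) v).
  have := l1norm_ge0 v; move: De; nra.
have hb := ler_wpM2l lam_ge0 (l1norm_support_le beta bhat).
have hc := ler_wpM2l mu_ge0 (l1norm_support_le c chat).
move: ef; rewrite (l1norm_onC J1) (l1norm_onC J2).
lra.
Qed.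

Lemma lasso_cone : w != 0 ->
  @restricted_cone R N T p lam mu (sparsity beta) (sparsity c) w.
Proof.
move=> w0; split=> //; exists J1, J2; rewrite !sparsityE; split=> //.
have s1 := sqrtNT_neq0 N_gt0 T_gt0 : Num.sqrt (N%:R * T%:R : R) != 0.
have s2 := sqrtT_neq0 T_gt0 : Num.sqrt (T%:R : R) != 0.
rewrite col_mxKu col_mxKd !l1norm_onZ !ger0_norm ?sqrtr_ge0 //.
have := lasso_basic; have := sqr_ge0 (l2norm (Z *m col_mx u v)).
set a1 := l1norm_on _ u; set a2 := l1norm_on _ v.
set b1 := l1norm_on _ u; set b2 := l1norm_on _ v => h1 h2.
rewrite [3 * L1 * _]mulrA [3 * L2 * _]mulrA ![L1 * (_ * _)]mulrA ![L2 * (_ * _)]mulrA.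
rewrite -[3 * L1 * _]mulrA -[3 * L2 * _]mulrA !divfK //; lra.
Qed.

(** The weighted l1-norms over the supports cost a factor [sqrt s] each when
    compared with the l2-norm. *)
Lemma lasso_quad_le :
  (w^T *m Psi X *m w) 0 0 <=
  3 * (L1 * Num.sqrt (sparsity beta)%:R + L2 * Num.sqrt (sparsity c)%:R) * l2norm w.
Proof.
rewrite Psi_quad //.
have s1 : 0 < Num.sqrt (N%:R * T%:R : R).
  by rewrite lt_neqAle sqrtr_ge0 eq_sym sqrtNT_neq0.
have s2 : 0 < Num.sqrt (T%:R : R).
  by rewrite lt_neqAle sqrtr_ge0 eq_sym sqrtT_neq0.
have b1 := mulr_ge0 lam_ge0 (l1norm_on_ge0 (~: J1)%SET u).
have b2 := mulr_ge0 mu_ge0 (l1norm_on_ge0 (~: J2)%SET v).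
have := lasso_basic.
have c1 : lam * l1norm_on J1 u <= L1 * Num.sqrt (sparsity beta)%:R * l2norm w.
  have -> : lam * l1norm_on J1 u = L1 * l1norm_on J1 (Num.sqrt (N%:R * T%:R) *: u).
    by rewrite l1norm_onZ gtr0_norm // (mulrA L1) divfK // gt_eqF.
  rewrite -(mulrA L1) ler_wpM2l ?divr_ge0 ?sqrtr_ge0 //.
  apply: le_trans (l1norm_on_le_l2norm _ _) _.
  by rewrite sparsityE ler_wpM2l ?sqrtr_ge0 // l2norm_col_mx_geu.
have c2 : mu * l1norm_on J2 v <= L2 * Num.sqrt (sparsity c)%:R * l2norm w.
  have -> : mu * l1norm_on J2 v = L2 * l1norm_on J2 (Num.sqrt T%:R *: v).
    by rewrite l1norm_onZ gtr0_norm // (mulrA L2) divfK // gt_eqF.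
  rewrite -(mulrA L2) ler_wpM2l ?divr_ge0 ?sqrtr_ge0 //.
  apply: le_trans (l1norm_on_le_l2norm _ _) _.
  by rewrite sparsityE ler_wpM2l ?sqrtr_ge0 // l2norm_col_mx_ged.
lra.
Qed.

(** If the value of [ksq] is infinite the cone is empty and the error is zero;
    this agrees with the right-hand side, where [fine ksq] is then zero. *)
Lemma lasso_error (ksq : \bar R) (M : 'M[R]_(p + N)) :
  ksq = kappa2 T lam mu M (sparsity beta) (sparsity c) -> (0 < ksq)%E ->
  (ksq * (2^-1)%:E <= kappa2 T lam mu (Psi X) (sparsity beta) (sparsity c))%E ->
  l2norm w <= 6 * (L1 * Num.sqrt (sparsity beta)%:R
                   + L2 * Num.sqrt (sparsity c)%:R) / fine ksq.
Proof.
move=> ksqE ksq0 B.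
have [w0|w0] := eqVneq w 0.
  rewrite w0 /l2norm; under eq_bigr do rewrite mxE expr0n.
  rewrite big1 // sqrtr0 divr_ge0 ?fine_ge0 ?(ltW ksq0) //.
  by rewrite mulr_ge0 // addr_ge0 // !mulr_ge0 ?divr_ge0 ?sqrtr_ge0 ?invr_ge0.
have cw := lasso_cone w0; have wp := l2norm_gt0 w0.
have kfin : ksq \is a fin_num.
  rewrite ge0_fin_numE ?(ltW ksq0) // ksqE.
  by apply: le_lt_trans (kappa2_le M cw) _; rewrite ltry.
have k0 : 0 < fine ksq by rewrite fine_gt0 // ksq0 /= -ge0_fin_numE // ltW.
move: B; rewrite -(fineK kfin) -EFinM => /kappa2_geP/(_ _ cw).
have := lasso_quad_le; rewrite ler_pdivlMr //.
set q := (_ *m _) 0 0; set A := L1 * _ + _.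
move=> h1 h2; have : fine ksq * 2^-1 * l2norm w ^+ 2 <= 3 * A * l2norm w.
  exact: le_trans h2 h1.
rewrite expr2 mulrA ler_pM2r //; lra.
Qed.

Lemma lasso_parts k : l2norm w <= k ->
  l2norm u <= k / Num.sqrt (N%:R * T%:R) /\ l2norm v <= k / Num.sqrt T%:R.
Proof.
move=> wk.
have s1 : 0 < Num.sqrt (N%:R * T%:R : R).
  by rewrite lt_neqAle sqrtr_ge0 eq_sym sqrtNT_neq0.
have s2 : 0 < Num.sqrt (T%:R : R).
  by rewrite lt_neqAle sqrtr_ge0 eq_sym sqrtT_neq0.
split; rewrite ler_pdivlMr // mulrC -l2normZ ?sqrtr_ge0 //; apply: le_trans wk.
  exact: l2norm_col_mx_geu.
exact: l2norm_col_mx_ged.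
Qed.

End lasso.

Lemma cauchy_schwarz2 (R : realType) (r1 r2 a b : R) : 0 <= r1 -> 0 <= r2 ->
  (Num.sqrt r1 * a + Num.sqrt r2 * b) ^+ 2 <= (r1 + r2) * (a ^+ 2 + b ^+ 2).
Proof.
move=> h1 h2; have e1 := sqr_sqrtr h1; have e2 := sqr_sqrtr h2.
rewrite -{2}e1 -{2}e2; have := sqr_ge0 (Num.sqrt r1 * b - Num.sqrt r2 * a).
by set s := Num.sqrt r1; set t := Num.sqrt r2; nra.
Qed.

(** Vectors of the cone have an l1-norm comparable to their l2-norm; the ratio
    of the two penalty levels enters because they weigh the two blocks. *)
Lemma cone_l1norm_le (R : realType) (N T p : nat) (lam mu lo hi : R)
    (s1 s2 : nat) (v : 'cV[R]_(p + N)) :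
  0 < lo ->
  lo <= lam / Num.sqrt (N%:R * T%:R) <= hi -> lo <= mu / Num.sqrt T%:R <= hi ->
  @restricted_cone R N T p lam mu s1 s2 v ->
  l1norm v ^+ 2 <= 16 * (hi / lo) ^+ 2 * (s1 + s2)%:R * l2norm v ^+ 2.
Proof.
move=> lo0; set L1 := lam / _; set L2 := mu / _.
move=> /andP[loL1 L1hi] /andP[loL2 L2hi] [_ [R1 [R2 [R1s R2s cone]]]].
rewrite -/L1 -/L2 in cone.
set v1 := usubmx v in cone *; set v2 := dsubmx v in cone *.
have vE : v = col_mx v1 v2 by rewrite vsubmxK.
have l1E : l1norm v = l1norm v1 + l1norm v2.
  rewrite vE /l1norm big_split_ord /=.
  by congr (_ + _); apply: eq_bigr => i _; rewrite ?col_mxEu ?col_mxEd.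
have l2E : l2norm v ^+ 2 = l2norm v1 ^+ 2 + l2norm v2 ^+ 2.
  by rewrite {1}vE sqr_l2norm_col_mx.
have on1 := l1norm_on_le_l2norm R1 v1; have on2 := l1norm_on_le_l2norm R2 v2.
have p1 := l1norm_on_ge0 R1 v1; have p2 := l1norm_on_ge0 R2 v2.
have q1 := l1norm_on_ge0 (~: R1)%SET v1; have q2 := l1norm_on_ge0 (~: R2)%SET v2.
have m1 : Num.sqrt #|R1|%:R * l2norm v1 <= Num.sqrt s1%:R * l2norm v1.
  by rewrite ler_wpM2r ?l2norm_ge0 // ler_wsqrtr // ler_nat.
have m2 : Num.sqrt #|R2|%:R * l2norm v2 <= Num.sqrt s2%:R * l2norm v2.
  by rewrite ler_wpM2r ?l2norm_ge0 // ler_wsqrtr // ler_nat.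
have hi0 : 0 < hi by lra.
have key : lo * l1norm v <= 4 * hi * (Num.sqrt s1%:R * l2norm v1 + Num.sqrt s2%:R * l2norm v2).
  rewrite l1E (l1norm_onC R1) (l1norm_onC R2 v2).
  have k1 : lo * l1norm_on (~: R1)%SET v1 <= L1 * l1norm_on (~: R1)%SET v1 by nra.
  have k2 : lo * l1norm_on (~: R2)%SET v2 <= L2 * l1norm_on (~: R2)%SET v2 by nra.
  have k3 : L1 * l1norm_on R1 v1 <= hi * l1norm_on R1 v1 by nra.
  have k4 : L2 * l1norm_on R2 v2 <= hi * l1norm_on R2 v2 by nra.
  have k5 : lo * l1norm_on R1 v1 <= hi * l1norm_on R1 v1 by nra.
  have k6 : lo * l1norm_on R2 v2 <= hi * l1norm_on R2 v2 by nra.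
  have k7 : hi * l1norm_on R1 v1 <= hi * (Num.sqrt s1%:R * l2norm v1).
    by rewrite ler_wpM2l ?(ltW hi0) //; lra.
  have k8 : hi * l1norm_on R2 v2 <= hi * (Num.sqrt s2%:R * l2norm v2).
    by rewrite ler_wpM2l ?(ltW hi0) //; lra.
  lra.
have lv := l1norm_ge0 v.
have S0 : 0 <= Num.sqrt s1%:R * l2norm v1 + Num.sqrt s2%:R * l2norm v2.
  by rewrite addr_ge0 // mulr_ge0 ?sqrtr_ge0 ?l2norm_ge0.
have cs := cauchy_schwarz2 (l2norm v1) (l2norm v2) (ler0n R s1) (ler0n R s2).
have key' : l1norm v <= 4 * (hi / lo) *
    (Num.sqrt s1%:R * l2norm v1 + Num.sqrt s2%:R * l2norm v2).
  rewrite -(ler_pM2l lo0); apply: (le_trans key).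
  rewrite le_eqVlt; apply/orP; left; apply/eqP; field; exact: lt0r_neq0.
apply: le_trans (_ : (4 * (hi / lo) * (Num.sqrt s1%:R * l2norm v1 + Num.sqrt s2%:R * l2norm v2)) ^+ 2 <= _).
  by rewrite lerXn2r // ?nnegrE // mulr_ge0 // mulr_ge0 // divr_ge0 // ltW.
have -> : 16 * (hi / lo) ^+ 2 * (s1 + s2)%:R * l2norm v ^+ 2 =
    (4 * (hi / lo)) ^+ 2 * ((s1 + s2)%:R * l2norm v ^+ 2) by ring.
by rewrite exprMn ler_wpM2l ?sqr_ge0 // natrD l2E.
Qed.

(** * Restricted eigenvalues of random matrices *)

(** On the cone the two quadratic forms differ by at most [eta] times the
    squared l1-norm, that is by at most [K / 2] times the squared l2-norm. *)
Lemma kappa2_perturb (R : realType) (N T p : nat) (lam mu K c eta : R)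
    (s1 s2 : nat) (M M' : 'M[R]_(p + N)) :
  0 <= eta -> eta * c <= K / 2 ->
  (forall v, @restricted_cone R N T p lam mu s1 s2 v ->
     l1norm v ^+ 2 <= c * l2norm v ^+ 2) ->
  (forall i j, `|M' i j - M i j| <= eta) ->
  (K%:E <= kappa2 T lam mu M s1 s2)%E ->
  ((K / 2)%:E <= kappa2 T lam mu M' s1 s2)%E.
Proof.
move=> eta0 etac l1 close /kappa2_geP KM; apply/kappa2_geP => v cv.
have h1 := KM _ cv; have h2 := l1 _ cv.
have h3 : `|(v^T *m (M' - M) *m v) 0 0| <= eta * l1norm v ^+ 2.
  by apply: quad_form_le => i j; rewrite !mxE.
have h4 : (v^T *m (M' - M) *m v) 0 0 = (v^T *m M' *m v) 0 0 - (v^T *m M *m v) 0 0.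
  by rewrite mulmxBr mulmxBl [LHS]mxE [X in _ + X]mxE.
rewrite h4 ler_norml in h3.
have h5 : eta * l1norm v ^+ 2 <= K / 2 * l2norm v ^+ 2.
  by apply: le_trans (ler_wpM2l eta0 h2) _; rewrite mulrA ler_wpM2r ?sqr_ge0.
by move/andP: h3 => [h3 _]; lra.
Qed.

Section quadratic_event.
Context {d : measure_display} {Omega : measurableType d} {R : realType} {n : nat}.
Variable M : Omega -> 'M[R]_n.
Hypothesis mM : forall i j, measurable_fun setT (fun w => M w i j).

Let box (Qm : 'M[rat]_n * nat) : set 'M[R]_n :=
  [set A | forall i j, `|A i j - ratr (Qm.1 i j)| <= Qm.2.+1%:R^-1].

Let measurable_box Qm : measurable (M @^-1` box Qm).
Proof.
have -> : M @^-1` box Qm = \bigcap_(i in [set: 'I_n]) \bigcap_(j in [set: 'I_n])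
    [set w | `|M w i j - ratr (Qm.1 i j)| <= Qm.2.+1%:R^-1].
  by apply/seteqP; split=> w h i => [_ j _|j]; exact: h.
apply: fin_bigcap_measurable => // i _; apply: fin_bigcap_measurable => // j _.
rewrite -[X in measurable X]setTI; apply: measurable_fun_le => //.
by apply: measurableT_comp => //; exact: measurable_funB.
Qed.

Let box_approx (A : 'M[R]_n) (m : nat) : exists Q, box (Q, m) A.
Proof.
have h i j : exists q : rat, `|A i j - ratr q| <= m.+1%:R^-1.
  have e0 : 0 < m.+1%:R^-1 :> R by rewrite invr_gt0.
  move: (m.+1%:R^-1) e0 => eps e0.
  have : A i j < A i j + eps by rewrite ltrDl.
  move=> /rat_in_itvoo[q]; rewrite in_itv /= => /andP[q1 q2]; exists q.
  by rewrite ler_norml; apply/andP; split; lra.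
pose f ij := xget 0 [set q : rat | `|A ij.1 ij.2 - ratr q| <= m.+1%:R^-1].
exists (\matrix_(i, j) f (i, j)) => i j; rewrite mxE /f.
by case: (h i j) => q hq; exact: (@xgetI _ _ [set q : rat | _] q hq).
Qed.

(** The complement is the preimage of an open set of matrices, hence of a
    countable union of boxes with rational centres. *)
Lemma measurable_quadratic_event (C : set 'cV[R]_n) (K : R) :
  measurable [set w | forall v, C v -> K * l2norm v ^+ 2 <= (v^T *m M w *m v) 0 0].
Proof.
rewrite -[X in measurable X]setCK; apply: measurableC.
pose low (A : 'M[R]_n) v := (v^T *m A *m v) 0 0 < K * l2norm v ^+ 2.
pose good Qm := exists2 v, C v & forall A, box Qm A -> low A v.
have -> : ~` [set w | forall v, C v -> K * l2norm v ^+ 2 <= (v^T *m M w *m v) 0 0] =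
    \bigcup_(Qm in [set: 'M[rat]_n * nat])
      (if `[< good Qm >] then M @^-1` box Qm else set0).
  apply/seteqP; split=> w; last first.
    move=> [Qm _]; case: asboolP => // -[v Cv low_v] bw h.
    by have := low_v _ bw; rewrite /low ltNge h.
  move=> /existsNP[v] /not_implyP[Cv] /negP; rewrite -ltNge => lowv.
  pose g := K * l2norm v ^+ 2 - (v^T *m M w *m v) 0 0.
  have g0 : 0 < g by rewrite subr_gt0.
  (* Two points of a box of radius 1 / (m + 1) are within twice that radius, and
     then their quadratic forms at v differ by less than the gap g. *)
  pose m := Num.truncn (2 * l1norm v ^+ 2 / g).
  have mg : 2 * l1norm v ^+ 2 / m.+1%:R < g.
    rewrite ltr_pdivrMr // [ltRHS]mulrC -ltr_pdivrMr //.
    exact: truncnS_gt.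
  have [Q bQ] := box_approx (M w) m.
  exists (Q, m) => //; rewrite ifT //; apply/asboolP; exists v => // A bA.
  have : `|(v^T *m (A - M w) *m v) 0 0| <= (2 / m.+1%:R) * l1norm v ^+ 2.
    apply: quad_form_le => i j; rewrite !mxE.
    have := bQ i j; have := bA i j; rewrite /= => h1 h2.
    rewrite -(subrKA (ratr (Q i j))); apply: le_trans (ler_normD _ _) _.
    by rewrite mulr_natl mulr2n lerD // distrC.
  have -> : (v^T *m (A - M w) *m v) 0 0 = (v^T *m A *m v) 0 0 - (v^T *m M w *m v) 0 0.
    by rewrite mulmxBr mulmxBl [LHS]mxE [X in _ + X]mxE.
  move/(le_trans (ler_norm _)); rewrite mulrAC => h.
  by rewrite /low; move: (le_lt_trans h mg); rewrite /g; lra.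
apply: countable_bigcupT_measurable => // Qm.
by case: asboolP.
Qed.

End quadratic_event.

(** * Tail bounds and power means *)

Section power_means.
Context {R : realType}.

Lemma powR_invl (z q : R) : 0 <= z -> z^-1 `^ q = (z `^ q)^-1.
Proof. by move=> z0; rewrite -(powR_inv1 z0) -powRrM mulN1r powRN. Qed.

(** Young's inequality against the constant one. *)
Lemma le_powR_affine (q z : R) : 1 <= q -> 0 <= z -> z <= z `^ q / q + (1 - q^-1).
Proof.
move=> q1 z0; have q0 : 0 < q by lra.
have [->|qn1] := eqVneq q 1; first by rewrite powRr1 // invr1 subrr mulr1 addr0.
have qgt1 : 1 < q by rewrite lt_neqAle eq_sym qn1.
have iq : q^-1 < 1 by rewrite invf_lt1.
pose p := (1 - q^-1)^-1.
have p0 : 0 < p by rewrite invr_gt0 subr_gt0.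
have := @conjugate_powR R z 1 q p z0 ler01 q0 p0.
by rewrite mulr1 powR1 mul1r /p invrK; apply; rewrite addrC subrK.
Qed.

(** Jensen's inequality for uniform weights: the previous affine bound is summed
    over the ratios of [z t] to the mean. *)
Lemma powR_sum_le (T : nat) (q : R) (z : 'I_T -> R) : (0 < T)%N -> 1 <= q ->
  (forall t, 0 <= z t) ->
  (T%:R^-1 * \sum_t z t) `^ q <= T%:R^-1 * \sum_t z t `^ q.
Proof.
move=> T0 q1 z0; have q0 : 0 < q by lra.
have TR : 0 < T%:R :> R by rewrite ltr0n.
have s0 : 0 <= \sum_t z t by apply: sumr_ge0 => t _; exact: z0.
have [e|s1] := eqVneq (\sum_t z t) 0.
  rewrite e mulr0 powR0 ?gt_eqF //; apply: mulr_ge0.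
    by rewrite invr_ge0 ltW.
  by apply: sumr_ge0 => t _; exact: powR_ge0.
set m := _ * _; have m0 : 0 < m by rewrite mulr_gt0 ?invr_gt0 // lt0r s1.
have h : \sum_t z t / m <= \sum_t ((z t / m) `^ q / q + (1 - q^-1)).
  by apply: ler_sum => t _; rewrite le_powR_affine // divr_ge0 // ltW.
rewrite -mulr_suml in h.
have e1 : (\sum_t z t) / m = T%:R.
  by rewrite /m; field; rewrite s1 gt_eqF.
have e2 : \sum_t ((z t / m) `^ q / q + (1 - q^-1)) =
    (\sum_t z t `^ q) / m `^ q / q + T%:R * (1 - q^-1).
  rewrite big_split /= sumr_const card_ord -[X in _ + X = _]mulr_natl.
  congr (_ + _); rewrite !mulr_suml; apply: eq_bigr => t _.
  rewrite powRM //; last by rewrite invr_ge0 ltW.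
  by rewrite powR_invl // ltW.
rewrite e1 e2 mulrBr mulr1 in h.
have mq : 0 < m `^ q by exact: powR_gt0.
rewrite ler_pdivlMl //; move: h; rewrite addrA [_ + T%:R]addrC -addrA => h.
have {}h : T%:R / q <= (\sum_t z t `^ q) / m `^ q / q by lra.
by move: h; rewrite ler_pM2r ?invr_gt0 // ler_pdivlMr.
Qed.

(** The arithmetic-geometric mean inequality for [`|x| `^ (2 * q)] and
    [`|y| `^ (2 * q)]. *)
Lemma powR_mul_le (q x y : R) :
  `|x * y| `^ q <= (`|x| `^ (2 * q) + `|y| `^ (2 * q)) / 2.
Proof.
rewrite normrM powRM // !(mulrC 2 q) !powRrM !powR_mulrn ?powR_ge0 //.
have := sqr_ge0 (`|x| `^ q - `|y| `^ q); nra.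
Qed.

End power_means.

Section tail_bounds.
Context {d : measure_display} {Omega : measurableType d} {R : realType}.
Variable P : probability Omega R.

Lemma measurable_norm_gt (f : Omega -> R) t : measurable_fun setT f ->
  measurable [set w | t < `|f w|].
Proof.
move=> mf; have -> : [set w | t < `|f w|] = ~` [set w | `|f w| <= t].
  by apply/seteqP; split=> w /=; rewrite ltNge => /negP.
apply: measurableC; rewrite -[X in measurable X]setTI.
by apply: measurable_fun_le => //; exact: measurableT_comp.
Qed.

Lemma markov_powR (r t : R) (f : Omega -> R) : 0 < r -> 0 < t ->
  moment_finite P r f ->
  fine (P [set w | t < `|f w|]) <= \int[P]_w (`|f w| `^ r) / t `^ r.
Proof.
move=> r0 t0 [mf rf]; have mA := measurable_norm_gt t mf.
rewrite ler_pdivlMr ?powR_gt0 // mulrC -Rintegral_indic_prob //.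
have iI : rintegrable P (\1_[set w | t < `|f w|] : Omega -> R).
  apply: rintegrable_le (rintegrable_cst P 1); first exact: measurable_indic.
  by move=> w; rewrite indicE normr_nat lern1 leq_b1.
rewrite -RintegralZl //; apply: le_Rintegral => //; first exact: rintegrableZ.
move=> w _; rewrite indicE; case: (boolP (w \in _)) => [|_].
  rewrite inE /= mulr1 => h; apply: ge0_ler_powR; rewrite ?nnegrE //; exact: ltW.
by rewrite mulr0 powR_ge0.
Qed.

(** The indicators of [G] and of the events [bad i] sum to at least one. *)
Lemma union_bound (I : finType) (G : set Omega) (bad : I -> set Omega) :
  measurable G -> (forall i, measurable (bad i)) ->
  (forall w, ~ G w -> exists i, bad i w) ->
  1 - \sum_i fine (P (bad i)) <= fine (P G).
Proof.
move=> mG mbad cover; rewrite lerBlDl.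
have iI A : measurable A -> rintegrable P (\1_A : Omega -> R).
  move=> mA; apply: rintegrable_le (rintegrable_cst P 1); first exact: measurable_indic.
  by move=> w; rewrite indicE normr_nat lern1 leq_b1.
have iB i : true -> rintegrable P (\1_(bad i) : Omega -> R) by move=> _; exact: iI.
have [h1 h2] := Rintegral_sum (index_enum I) iB.
rewrite -[leLHS](Rintegral_prob_cst P 1) -(Rintegral_indic_prob P mG).
under eq_bigr do rewrite -Rintegral_indic_prob //.
rewrite -h2 -RintegralD //; last exact: iI.
apply: le_Rintegral => //; first exact: rintegrable_cst.
  exact: rintegrableD h1 (iI _ mG).
move=> w _; have nn : 0 <= \sum_i (\1_(bad i) w : R).
  by apply: sumr_ge0 => i _; rewrite indicE.
rewrite indicE; case: (boolP (w \in G)) => [_|]; first by rewrite lerDr.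
move/negP; rewrite inE => /cover[i bi].
rewrite addr0 (bigD1 i) //= indicE mem_set // lerDl.
by apply: sumr_ge0 => j _; rewrite indicE.
Qed.

(** Both sides are integrals against the common law. *)
Lemma ge0_integral_identically (I : Type) (d' : measure_display)
    (E : measurableType d') (V : I -> Omega -> E) (h : E -> \bar R) i j :
  identically_distributed P V -> (forall i, measurable_fun setT (V i)) ->
  measurable_fun setT h -> (forall z, (0 <= h z)%E) ->
  (\int[P]_w h (V i w) = \int[P]_w h (V j w))%E.
Proof.
move=> idd mV mh h0.
pose V' k : {mfun Omega >-> E} := HB.pack (V k) (isMeasurableFun.Build _ _ _ _ _ (mV k)).
have e k : (\int[P]_w h (V k w) = \int[distribution P (V' k)]_z h z)%E.
  by rewrite ge0_integral_distribution.
rewrite !e; apply: eq_measure_integral => A mA _; exact: idd.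
Qed.

End tail_bounds.

(** * Moments of the panel variables *)

Section panel_moments.
Context {d : measure_display} {Omega : measurableType d} {R : realType}.
Variable P : probability Omega R.
Context {N T p : nat}.
Variables (r : R) (x : 'I_N -> 'I_T -> 'I_p -> Omega -> R)
  (eps : 'I_N -> 'I_T -> Omega -> R) (i1 : 'I_N).
Hypotheses (r2 : 2 <= r) (T_gt0 : (0 < T)%N).
Hypotheses (mx : forall i t k, measurable_fun setT (x i t k))
  (me : forall i t, measurable_fun setT (eps i t)).
Hypotheses (A1 : assumption_A1 P x eps) (A2 : assumption_A2a P x eps r i1).

Local Notation E := ((T.-tuple (p.-tuple R)) * (T.-tuple R))%type.
Local Notation sigma := (max_Lrnorm P r (eps i1)).
Local Notation C := (moment_const r).

Let V i w : E := (Xvec x i w, epsvec eps i w).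
Let xc t k (z : E) : R := tnth (tnth z.1 t) k.
Let ec t (z : E) : R := tnth z.2 t.

Let xcE i t k w : xc t k (V i w) = x i t k w.
Proof. by rewrite /xc /V /= !tnth_mktuple. Qed.

Let ecE i t w : ec t (V i w) = eps i t w.
Proof. by rewrite /ec /V /= !tnth_mktuple. Qed.

Lemma measurable_Xvec i : measurable_fun setT (Xvec x i).
Proof.
apply/measurable_fun_tnthP => t; apply/measurable_fun_tnthP => k.
have -> : (fun z : p.-tuple R => tnth z k) \o
    ((fun z : T.-tuple (p.-tuple R) => tnth z t) \o Xvec x i) = x i t k.
  by apply/funext => w; rewrite /= !tnth_mktuple.
exact: mx.
Qed.

Lemma measurable_epsvec i : measurable_fun setT (epsvec eps i).
Proof.
apply/measurable_fun_tnthP => t.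
have -> : (fun z : T.-tuple R => tnth z t) \o epsvec eps i = eps i t.
  by apply/funext => w; rewrite /= !tnth_mktuple.
exact: me.
Qed.

Let mV i : measurable_fun setT (V i).
Proof.
apply/measurable_fun_pairP; split; first exact: measurable_Xvec.
exact: measurable_epsvec.
Qed.

Let mxc t k : measurable_fun setT (xc t k).
Proof.
apply: (measurableT_comp (measurable_tnth k)).
exact: (measurableT_comp (measurable_tnth t) measurable_fst).
Qed.

Let mec t : measurable_fun setT (ec t).
Proof. exact: (measurableT_comp (measurable_tnth t) measurable_snd). Qed.

Let r0 : 0 < r. Proof. by rewrite (lt_le_trans _ r2). Qed.

Let C_ge0 : 0 <= C. Proof. by rewrite ltW // moment_const_gt0 // ltW. Qed.

Lemma covariate_moment i t k :
  moment_finite P r (x i t k) /\ \int[P]_w (`|x i t k w| `^ r) <= 1.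
Proof.
have [_ idd _ _] := A1; have [_ _ A2x] := A2.
have h : (\int[P]_w (`|x i t k w| `^ r)%:E <= 1)%E.
  have e := @ge0_integral_identically _ _ _ P _ _ _ V
    (fun z => (`|xc t k z| `^ r)%:E) i i1 idd mV.
  have -> : (\int[P]_w (`|x i t k w| `^ r)%:E = \int[P]_w (`|x i1 t k w| `^ r)%:E)%E.
    transitivity (\int[P]_w (`|xc t k (V i w)| `^ r)%:E)%E.
      by apply: eq_integral => w _; rewrite xcE.
    rewrite e => [| |z]; last by rewrite lee_fin powR_ge0.
      by apply: eq_integral => w _; rewrite xcE.
    by apply/measurable_EFinP/measurable_powR_norm; exact: mxc.
  have := A2x k; apply: le_trans.
  have := @le_bigmax _ _ _ 0%E (fun t => 'E_P[fun w => (`|x i1 t k w| `^ r)%R])%E t.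
  by rewrite unlock.
have iX : rintegrable P (fun w => `|x i t k w| `^ r).
  apply: rintegrable_ge0; first exact: measurable_powR_norm.
    by move=> w; exact: powR_ge0.
  exact: le_lt_trans h (ltry 1).
split; first by split.
by rewrite -lee_fin -EFin_Rintegral.
Qed.

Lemma error_moment i t :
  moment_finite P r (eps i t) /\ \int[P]_w (`|eps i t w| `^ r) <= sigma `^ r.
Proof.
have [_ idd _ _] := A1; have [_ A2e _] := A2.
have e : (\int[P]_w (`|eps i t w| `^ r)%:E = \int[P]_w (`|eps i1 t w| `^ r)%:E)%E.
  have e := @ge0_integral_identically _ _ _ P _ _ _ V
    (fun z => (`|ec t z| `^ r)%:E) i i1 idd mV.
  transitivity (\int[P]_w (`|ec t (V i w)| `^ r)%:E)%E.
    by apply: eq_integral => w _; rewrite ecE.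
  rewrite e => [| |z]; last by rewrite lee_fin powR_ge0.
    by apply: eq_integral => w _; rewrite ecE.
  by apply/measurable_EFinP/measurable_powR_norm; exact: mec.
have fin1 : (\int[P]_w (`|eps i1 t w| `^ r)%:E < +oo)%E.
  by have := A2e t; rewrite unlock.
have iX : rintegrable P (fun w => `|eps i t w| `^ r).
  apply: rintegrable_ge0; first exact: measurable_powR_norm.
    by move=> w; exact: powR_ge0.
  by rewrite e.
split; first by split.
rewrite /Rintegral e.
have : fine ('N[P]_(r%:E)[EFin \o eps i1 t])%E <= sigma.
  exact: (@le_bigmax _ _ _ 0 (fun t => fine ('N[P]_(r%:E)[EFin \o eps i1 t])%E) t).
rewrite unlock fine_poweR /=.
set b := fine _.
have b0 : 0 <= b by apply: fine_ge0; apply: integral_ge0 => w _; rewrite lee_fin powR_ge0.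
move=> h; have /(_ _ _ h) := @ge0_ler_powR _ r (ltW r0) (b `^ r^-1) sigma.
rewrite -powRrM mulVf ?(gt_eqF r0) // (powRr1 b0); apply.
  by rewrite nnegrE powR_ge0.
by rewrite nnegrE; apply: le_trans h; exact: powR_ge0.
Qed.

Lemma sigma_ge0 : 0 <= sigma.
Proof.
apply: le_trans (@le_bigmax _ _ _ 0 (fun t => fine ('N[P]_(r%:E)[EFin \o eps i1 t])%E)
  (Ordinal T_gt0)).
by apply: fine_ge0; exact: Lnorm_ge0.
Qed.

Lemma error_martingale i (k : 'I_T) A :
  natural_filtration (eps i) k A -> \int[P]_(w in A) eps i k w = 0.
Proof.
have [_ _ _ mds] := A1; move=> FA; have [_ _ [_ _ /(_ _ FA)]] := mds i k.
by rewrite /Rintegral => <-; rewrite integral0.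
Qed.

Lemma error_centered i t : \int[P]_w eps i t w = 0.
Proof. by apply: error_martingale; exact: (@measurableT _ (g_sigma_algebraType _)). Qed.

Lemma weighted_error_moment i (a : 'I_T -> R) :
  moment_finite P r (fun w => \sum_t a t * eps i t w) /\
  \int[P]_w (`|\sum_t a t * eps i t w| `^ r) <=
    C * T%:R `^ (r / 2 - 1) * sigma `^ r * \sum_t `|a t| `^ r.
Proof.
have me' t : moment_finite P r (eps i t) by case: (error_moment i t).
split; first by apply: moment_finite_sum => // t _; exact: moment_finiteZ.
apply: le_trans (moment_martingale_le _ r2 T_gt0 me' (@error_martingale i)) _.
rewrite -[leRHS]mulrA ler_wpM2l //.
  by rewrite mulr_ge0 ?powR_ge0.
rewrite mulr_sumr; apply: ler_sum => t _; rewrite mulrC ler_wpM2r ?powR_ge0 //.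
by case: (error_moment i t).
Qed.

Lemma powR_half_card : T%:R `^ (r / 2 - 1) * T%:R = T%:R `^ (r / 2) :> R.
Proof. by rewrite [LHS]mulrC mulr_powRB1 // divr_gt0. Qed.

Lemma error_sum_moment i :
  moment_finite P r (fun w => \sum_t eps i t w) /\
  \int[P]_w (`|\sum_t eps i t w| `^ r) <= C * T%:R `^ (r / 2) * sigma `^ r.
Proof.
have := weighted_error_moment i (fun=> 1).
have e1 w : \sum_t 1 * eps i t w = \sum_t eps i t w.
  by under eq_bigr do rewrite mul1r.
under eq_fun do rewrite e1.
under eq_Rintegral do rewrite e1.
under [X in _ <= _ * X]eq_bigr do rewrite normr1 powR1.
rewrite sumr_const card_ord -powR_half_card.
by have -> : C * (T%:R `^ (r / 2 - 1) * T%:R) * sigma `^ r =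
  C * T%:R `^ (r / 2 - 1) * sigma `^ r * T%:R by ring.
Qed.

Lemma covariate_error_independent i t k : independent P (x i t k) (eps i t).
Proof.
have [_ _ ind _] := A1; move=> A B mA mB.
have := ind i ((fun z : T.-tuple (p.-tuple R) => tnth (tnth z t) k) @^-1` A)
  ((fun z : T.-tuple R => tnth z t) @^-1` B).
have -> : Xvec x i @^-1` ((fun z : T.-tuple (p.-tuple R) => tnth (tnth z t) k) @^-1` A)
    = x i t k @^-1` A.
  by apply/seteqP; split=> w; rewrite /preimage /= !tnth_mktuple.
have -> : epsvec eps i @^-1` ((fun z : T.-tuple R => tnth z t) @^-1` B) = eps i t @^-1` B.
  by apply/seteqP; split=> w; rewrite /preimage /= !tnth_mktuple.
apply; apply: measurable_preimage => //; last exact: measurable_tnth.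
exact: (measurableT_comp (measurable_tnth k) (measurable_tnth t)).
Qed.

Local Notation score i k := (fun w => \sum_t x i t k w * eps i t w).

(** Conditionally on the covariates the scores are sums of weighted martingale
    differences; by independence the conditioning is an integral over a second
    sample point [v]. *)
Lemma score_moment i k :
  moment_finite P r (score i k) /\
  \int[P]_w (`|\sum_t x i t k w * eps i t w| `^ r) <=
    C * T%:R `^ (r / 2) * sigma `^ r.
Proof.
have [_ _ ind _] := A1.
have mS : measurable_fun setT (score i k).
  by apply: measurable_sum => t; apply: measurable_funM.
pose h (z : T.-tuple (p.-tuple R) * T.-tuple R) : \bar R :=
  (`|\sum_t xc t k z * ec t z| `^ r)%:E.
have mh : measurable_fun setT h.
  apply/measurable_EFinP/measurable_powR_norm.
  apply: measurable_sum => t; apply: measurable_funM; [exact: mxc|exact: mec].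
have h0 z : (0 <= h z)%E by rewrite lee_fin powR_ge0.
have eh : (\int[P]_w (`|\sum_t x i t k w * eps i t w| `^ r)%:E =
    \int[P]_v \int[P]_w h (Xvec x i v, epsvec eps i w))%E.
  rewrite -(ge0_integral_independent (measurable_Xvec i) (measurable_epsvec i) (ind i) mh h0).
  apply: eq_integral => w _; rewrite /h; congr ((`| _ | `^ r)%:E).
  by apply: eq_bigr => t _; rewrite -xcE -ecE.
set cc := C * T%:R `^ (r / 2 - 1) * sigma `^ r.
have cc0 : 0 <= cc.
  by apply: mulr_ge0; [apply: mulr_ge0|]; rewrite ?powR_ge0.
have inner v : (\int[P]_w h (Xvec x i v, epsvec eps i w) <=
    (cc * \sum_t `|x i t k v| `^ r)%:E)%E.
  have [[mw iw] bw] := weighted_error_moment i (fun t => x i t k v).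
  rewrite (_ : (\int[P]_w _ = \int[P]_w (`|\sum_t x i t k v * eps i t w| `^ r)%:E)%E).
    by rewrite EFin_Rintegral // lee_fin.
  apply: eq_integral => w _; rewrite /h /xc /ec /=; congr ((`| _ | `^ r)%:E).
  by apply: eq_bigr => t _; rewrite !tnth_mktuple.
have iX t : true -> rintegrable P (fun w => `|x i t k w| `^ r).
  by move=> _; case: (covariate_moment i t k) => -[].
have [iS eS] := Rintegral_sum (index_enum _) iX.
have bound : (\int[P]_w (`|\sum_t x i t k w * eps i t w| `^ r)%:E <=
    (C * T%:R `^ (r / 2) * sigma `^ r)%:E)%E.
  rewrite eh; apply: (@le_trans _ _ (\int[P]_v (cc * \sum_t `|x i t k v| `^ r)%:E)%E).
    apply: ge0_le_integral => //.
    - by move=> v _; apply: integral_ge0.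
    - exact (measurable_integral_independent P (measurable_Xvec i) (measurable_epsvec i) mh h0).
    - by apply/measurable_EFinP; apply: rintegrable_measurable (rintegrableZ cc iS).
  rewrite EFin_Rintegral ?lee_fin; last exact: rintegrableZ.
  rewrite RintegralZl // eS -powR_half_card.
  have -> : C * (T%:R `^ (r / 2 - 1) * T%:R) * sigma `^ r = cc * T%:R.
    by rewrite /cc; ring.
  rewrite ler_wpM2l //; apply: (@le_trans _ _ (\sum_(t < T) 1)).
    by apply: ler_sum => t _; case: (covariate_moment i t k).
  by rewrite sumr_const card_ord.
have iU : rintegrable P (fun w => `|\sum_t x i t k w * eps i t w| `^ r).
  apply: rintegrable_ge0; first exact: measurable_powR_norm.
    by move=> w; exact: powR_ge0.
  by apply: le_lt_trans bound (ltry _).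
split; first by split.
by rewrite -lee_fin -EFin_Rintegral.
Qed.

(** By linearity: each covariate is independent of the centred error that it
    multiplies. *)
Lemma score_centered i k : \int[P]_w (\sum_t x i t k w * eps i t w) = 0.
Proof.
have re t : moment_finite P 2 (eps i t).
  by apply: rintegrable_powR_le r2 _ => //; case: (error_moment i t).
have rx t : moment_finite P 2 (x i t k).
  by apply: rintegrable_powR_le r2 _ => //; case: (covariate_moment i t k).
have ixe t : true -> rintegrable P (fun w => x i t k w * eps i t w).
  move=> _; apply: eq_integrable (rintegrable_spow_mul (lexx 2) (rx t) (re t)) => //.
  by move=> w _; rewrite /= /spow subrr powRr0 mulr1.
have [_ ->] := Rintegral_sum (index_enum _) ixe.
rewrite big1 // => t _; apply: Rintegral_indep_mul.
- exact: covariate_error_independent.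
- by apply: moment_finite_rintegrable (re t); lra.
- exact: mx.
- exact: ixe.
- exact: error_centered.
Qed.

(** The moment inequality over the individuals is applied to scores that already
    satisfy it over time, hence the squared constant. *)
Lemma score_sum_moment k : (0 < N)%N ->
  moment_finite P r (fun w => \sum_i \sum_t x i t k w * eps i t w) /\
  \int[P]_w (`|\sum_i \sum_t x i t k w * eps i t w| `^ r) <=
    C ^+ 2 * (N%:R * T%:R) `^ (r / 2) * sigma `^ r.
Proof.
move=> N0; have [ind _ _ _] := A1.
have mU i : moment_finite P r (score i k) by case: (score_moment i k).
split; first by apply: moment_finite_sum.
pose g (z : E) := \sum_t xc t k z * ec t z.
have mg : measurable_fun setT g.
  apply: measurable_sum => t; apply: measurable_funM; [exact: mxc|exact: mec].
have indU : mutually_independent P (fun i => score i k).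
  have -> : (fun i => score i k) = (fun i => g \o V i).
    apply/funext => i; apply/funext => w; rewrite /g /=.
    by apply: eq_bigr => t _; rewrite xcE ecE.
  exact: (mutually_independent_comp (g := fun=> g)).
apply: le_trans (moment_independent_le r2 N0 indU mU (fun i => score_centered i k)) _.
have -> : C ^+ 2 * (N%:R * T%:R) `^ (r / 2) * sigma `^ r =
  C * N%:R `^ (r / 2 - 1) * \sum_(i < N) (C * T%:R `^ (r / 2) * sigma `^ r).
  have q0 : 0 < r / 2 by rewrite divr_gt0.
  have eN := mulr_powRB1 (ler0n R N) q0.
  by rewrite sumr_const card_ord -[X in _ = _ * X]mulr_natl powRM // -eN; ring.
apply: ler_wpM2l; first by apply: mulr_ge0; rewrite ?powR_ge0.
by apply: ler_sum => i _; case: (score_moment i k).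
Qed.


(** Integrating the affine bound of [`|x| `^ s] by [`|x| `^ r] keeps the
    normalization at one exactly. *)
Lemma covariate_moment_le1 i t k s : 0 < s -> s <= r ->
  moment_finite P s (x i t k) /\ \int[P]_w (`|x i t k w| `^ s) <= 1.
Proof.
move=> s0 sr; have [rx x1] := covariate_moment i t k.
have sx : moment_finite P s (x i t k) by apply: rintegrable_powR_le rx => //; exact: ltW.
split=> //; have qs : 1 <= r / s by rewrite ler_pdivlMr // mul1r.
have -> : 1 = (r / s)^-1 * 1 + (1 - (r / s)^-1) :> R by ring.
apply: (@le_trans _ _ (\int[P]_w ((r / s)^-1 * (`|x i t k w| `^ r) + (1 - (r / s)^-1)))).
  apply: le_Rintegral => //; first by case: sx.
    by apply: rintegrableD (rintegrableZ _ rx.2) _; exact: rintegrable_cst.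
  move=> w _; have := le_powR_affine qs (powR_ge0 `|x i t k w| s).
  by rewrite -powRrM mulrC [s * _]mulrC divfK ?gt_eqF // [(r / s)^-1 * _]mulrC.
rewrite RintegralD //; [|exact: rintegrableZ rx.2|exact: rintegrable_cst].
rewrite RintegralZl ?Rintegral_prob_cst //; last by case: rx.
by rewrite lerD2r ler_wpM2l // invr_ge0 (le_trans ler01).
Qed.

Lemma covariate_product_moment i t k l s : 0 < s -> 2 * s <= r ->
  moment_finite P s (fun w => x i t k w * x i t l w) /\
  \int[P]_w (`|x i t k w * x i t l w| `^ s) <= 1.
Proof.
move=> s0 sr; have s20 : 0 < 2 * s by rewrite mulr_gt0.
have [[_ ik] bk] := covariate_moment_le1 i t k s20 sr.
have [[_ il] bl] := covariate_moment_le1 i t l s20 sr.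
have iD := rintegrableZ 2^-1 (rintegrableD ik il).
have mxx : measurable_fun setT (fun w => x i t k w * x i t l w).
  exact: measurable_funM.
have le w : `|x i t k w * x i t l w| `^ s <=
    2^-1 * (`|x i t k w| `^ (2 * s) + `|x i t l w| `^ (2 * s)).
  by rewrite [leRHS]mulrC powR_mul_le.
have iX : rintegrable P (fun w => `|x i t k w * x i t l w| `^ s).
  apply: rintegrable_le (measurable_powR_norm _ mxx) _ iD => w.
  by rewrite ger0_norm ?powR_ge0.
split; first by split.
apply: (@le_trans _ _ (\int[P]_w (2^-1 * (`|x i t k w| `^ (2 * s) + `|x i t l w| `^ (2 * s))))).
  exact: le_Rintegral.
rewrite RintegralZl //; last exact: rintegrableD.
rewrite RintegralD // mulrC ler_pdivrMr // mul1r; exact: lerD.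
Qed.

Lemma time_mean_moment s (z : 'I_T -> Omega -> R) : 1 <= s ->
  (forall t, moment_finite P s (z t) /\ \int[P]_w (`|z t w| `^ s) <= 1) ->
  moment_finite P s (fun w => T%:R^-1 * \sum_t z t w) /\
  \int[P]_w (`|T%:R^-1 * \sum_t z t w| `^ s) <= 1.
Proof.
move=> s1 mz; have s0 : 0 < s by rewrite (lt_le_trans _ s1).
have mfin : moment_finite P s (fun w => T%:R^-1 * \sum_t z t w).
  apply: moment_finiteZ; apply: moment_finite_sum => // t _; exact: (mz t).1.
split=> //.
have iz t : true -> rintegrable P (fun w => `|z t w| `^ s).
  by move=> _; case: (mz t) => -[].
have [iS eS] := Rintegral_sum (index_enum _) iz.
apply: (@le_trans _ _ (\int[P]_w (T%:R^-1 * \sum_t `|z t w| `^ s))).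
  apply: le_Rintegral => //; [exact: mfin.2|exact: rintegrableZ|move=> w _].
  apply: le_trans (powR_sum_le T_gt0 s1 (fun t => normr_ge0 (z t w))).
  apply: (ge0_ler_powR (ltW s0)); rewrite ?nnegrE //.
    by rewrite mulr_ge0 ?invr_ge0 // sumr_ge0.
  by rewrite normrM ger0_norm ?invr_ge0 // ler_wpM2l ?invr_ge0 // ler_norm_sum.
rewrite RintegralZl // eS mulrC ler_pdivrMr ?ltr0n // mul1r.
apply: (@le_trans _ _ (\sum_(t < T) 1)).
  by apply: ler_sum => t _; case: (mz t).
by rewrite sumr_const card_ord.
Qed.

Local Notation gram i k l := (fun w => T%:R^-1 * \sum_t (x i t k w * x i t l w)).

Let gram1 i k l : moment_finite P 1 (gram i k l) /\
  \int[P]_w (`|T%:R^-1 * \sum_t (x i t k w * x i t l w)| `^ 1) <= 1.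
Proof.
apply: time_mean_moment => // t; apply: covariate_product_moment => //.
by rewrite mulr1.
Qed.

Lemma gram_rintegrable i k l : rintegrable P (gram i k l).
Proof. by apply: moment_finite_rintegrable (gram1 i k l).1. Qed.

Lemma gram_mean_le1 i k l :
  `|\int[P]_w (T%:R^-1 * \sum_t (x i t k w * x i t l w))| <= 1.
Proof.
have [_] := gram1 i k l; apply: le_trans.
apply: le_trans (le_normr_Rintegral _ (gram_rintegrable i k l)) _ => //.
rewrite le_eqVlt; apply/orP; left; apply/eqP.
by apply: eq_Rintegral => w _; rewrite powRr1.
Qed.

Lemma Gamma_entryE k l : Gamma P x (lshift N k) (lshift N l) =
  N%:R^-1 * \sum_i \int[P]_w (T%:R^-1 * \sum_t (x i t k w * x i t l w)).
Proof.
have ig i : true -> rintegrable P (gram i k l) by move=> _; exact: gram_rintegrable.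
have [iS eS] := Rintegral_sum (index_enum _) ig.
rewrite /Gamma block_mxEul mxE unlock -eS -RintegralZl //.
apply: eq_Rintegral => w _; rewrite stack_tr_mul summxE.
rewrite invfM mulrC -mulrA; congr (_ * _); rewrite mulr_sumr.
apply: eq_bigr => i _; rewrite mxE; congr (_ * _).
by apply: eq_bigr => t _; rewrite !mxE.
Qed.

Lemma Gamma_diag_le1 k : (0 < N)%N -> Gamma P x (lshift N k) (lshift N k) <= 1.
Proof.
move=> N0; rewrite Gamma_entryE mulrC ler_pdivrMr ?ltr0n // mul1r.
apply: (@le_trans _ _ (\sum_(i < N) 1)).
  by apply: ler_sum => i _; apply: le_trans (ler_norm _) (gram_mean_le1 _ _ _).
by rewrite sumr_const card_ord.
Qed.

Section fourth_moments.
Hypotheses (r4 : 4 <= r) (N_gt0 : (0 < N)%N).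
Local Notation q := (r / 2).

Let q2 : 2 <= q. Proof. by rewrite ler_pdivlMr // -natrM. Qed.
Let q0 : 0 < q. Proof. by rewrite divr_gt0. Qed.
Let NR : 0 < N%:R :> R. Proof. by rewrite ltr0n. Qed.

(** Markov's inequality of order [q = r / 2] for the centred average: the
    moments of order [r] of two covariates bound those of order [q] of their
    product. *)
Lemma gram_tail k l eta : 0 < eta ->
  fine (P [set w | eta <
    `|N%:R^-1 * \sum_i (T%:R^-1 * \sum_t (x i t k w * x i t l w))
      - Gamma P x (lshift N k) (lshift N l)|])
  <= moment_const q * 2 `^ (q + 1) / (N%:R `^ (r / 4) * eta `^ q).
Proof.
move=> eta0.
pose m i := \int[P]_w (T%:R^-1 * \sum_t (x i t k w * x i t l w)).
pose W i w := T%:R^-1 * \sum_t (x i t k w * x i t l w) - m i.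
have gq i : moment_finite P q (gram i k l) /\
    \int[P]_w (`|T%:R^-1 * \sum_t (x i t k w * x i t l w)| `^ q) <= 1.
  apply: time_mean_moment => [|t]; first by rewrite (le_trans _ q2) // ler1n.
  by apply: covariate_product_moment => //; rewrite mulrC divfK.
have mcst i : moment_finite P q (fun=> - m i).
  by split=> //; exact: rintegrable_cst.
have mW i : moment_finite P q (W i) by apply: moment_finiteD (gq i).1 (mcst i); exact: ltW.
have bW i : \int[P]_w (`|W i w| `^ q) <= 2 `^ (q + 1).
  have iD := rintegrableZ (2 `^ q) (rintegrableD (gq i).1.2 (mcst i).2).
  apply: (@le_trans _ _ (\int[P]_w (2 `^ q * (`|T%:R^-1 * \sum_t (x i t k w * x i t l w)| `^ q
      + `|- m i| `^ q)))).
    apply: le_Rintegral => //; first exact: (mW i).2.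
    by move=> w _; apply: powR_norm_add_le; exact: ltW.
  rewrite RintegralZl //; last exact: rintegrableD (gq i).1.2 (mcst i).2.
  rewrite RintegralD //; [|exact: (gq i).1.2|exact: (mcst i).2].
  rewrite Rintegral_prob_cst powRD ?powRr1 // ?ler_wpM2l ?powR_ge0 //; last first.
    by apply/implyP => _; rewrite pnatr_eq0.
  apply: (@le_trans _ _ (1 + 1)); last by lra.
  apply: lerD; first exact: (gq i).2.
  apply: (@le_trans _ _ (1 `^ q)); last by rewrite powR1.
  apply: (ge0_ler_powR (ltW q0)); rewrite ?nnegrE //.
  by rewrite normrN gram_mean_le1.
have cW i : \int[P]_w W i w = 0.
  rewrite RintegralB //; [|exact: gram_rintegrable|exact: rintegrable_cst].
  by rewrite Rintegral_prob_cst subrr.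
have indW : mutually_independent P W.
  have [ind _ _ _] := A1.
  pose g i (z : E) := T%:R^-1 * \sum_t (xc t k z * xc t l z) - m i.
  have -> : W = (fun i => g i \o V i).
    apply/funext => i; apply/funext => w; rewrite /W /g /=; congr (_ * _ - _).
    by apply: eq_bigr => t _; rewrite !xcE.
  apply: mutually_independent_comp ind => i.
  apply: measurable_funB => //; apply: measurable_funM => //.
  by apply: measurable_sum => t; apply: measurable_funM; exact: mxc.
have eqset : [set w | eta < `|N%:R^-1 * \sum_i (T%:R^-1 * \sum_t (x i t k w * x i t l w))
      - Gamma P x (lshift N k) (lshift N l)|]
    = [set w | N%:R * eta < `|\sum_i W i w|].
  apply/seteqP; split=> w /=;
    rewrite Gamma_entryE -mulrBr -sumrB normrM gtr0_norm ?invr_gt0 //;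
    by rewrite ltr_pdivlMl.
rewrite eqset.
have mS : moment_finite P q (fun w => \sum_i W i w) by apply: moment_finite_sum.
apply: le_trans (markov_powR q0 (mulr_gt0 NR eta0) mS) _.
have b := moment_independent_le q2 N_gt0 indW mW cW.
have {}b : \int[P]_w (`|\sum_i W i w| `^ q) <=
    moment_const q * 2 `^ (q + 1) * N%:R `^ (q / 2).
  apply: le_trans b _.
  have q20 : 0 < q / 2 by rewrite divr_gt0.
  have eN := mulr_powRB1 (ler0n R N) q20.
  have -> : moment_const q * 2 `^ (q + 1) * N%:R `^ (q / 2) =
      moment_const q * N%:R `^ (q / 2 - 1) * \sum_(i < N) 2 `^ (q + 1).
    by rewrite sumr_const card_ord -[X in _ = _ * X]mulr_natl -eN; ring.
  apply: ler_wpM2l; last by apply: ler_sum => i _.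
  by rewrite mulr_ge0 ?powR_ge0 // ltW // moment_const_gt0 // ltW.
have Nq : 0 < N%:R `^ (q / 2) :> R by exact: powR_gt0.
have eq : 0 < eta `^ q by exact: powR_gt0.
rewrite ler_pdivrMr ?powR_gt0 ?mulr_gt0 //; apply: le_trans b _.
rewrite powRM ?(ltW eta0) //.
have -> : N%:R `^ q = N%:R `^ (q / 2) * N%:R `^ (q / 2) :> R.
  by rewrite -powRD ?gt_eqF ?implybT // -splitr.
have -> : r / 4 = q / 2 by field.
by rewrite le_eqVlt; apply/orP; left; apply/eqP; field; rewrite !gt_eqF.
Qed.

(** The same order [q] is used as for the products of covariates, so that both
    bounds have the same rate. *)
Lemma time_sum_tail i k eta : 0 < eta ->
  fine (P [set w | eta <
    `|(Num.sqrt (N%:R * T%:R) * Num.sqrt T%:R)^-1 * \sum_t x i t k w|])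
  <= 1 / (N%:R `^ (r / 4) * eta `^ q).
Proof.
move=> eta0.
have [mV1 bV] : moment_finite P q (fun w => T%:R^-1 * \sum_t x i t k w) /\
    \int[P]_w (`|T%:R^-1 * \sum_t x i t k w| `^ q) <= 1.
  apply: time_mean_moment => [|t]; first by rewrite (le_trans _ q2) // ler1n.
  by apply: covariate_moment_le1 => //; rewrite ler_pdivrMr // ler_peMr ?ltW // ltr1n.
have sN : 0 < Num.sqrt N%:R :> R by rewrite sqrtr_gt0.
have eqset : [set w | eta <
    `|(Num.sqrt (N%:R * T%:R) * Num.sqrt T%:R)^-1 * \sum_t x i t k w|]
    = [set w | Num.sqrt N%:R * eta < `|T%:R^-1 * \sum_t x i t k w|].
  have e : (Num.sqrt (N%:R * T%:R) * Num.sqrt T%:R)^-1 = (Num.sqrt N%:R)^-1 * T%:R^-1 :> R.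
    by rewrite sqrtrM // -mulrA -expr2 sqr_sqrtr // invfM.
  have e2 w : (eta < `|(Num.sqrt (N%:R * T%:R) * Num.sqrt T%:R)^-1 * \sum_t x i t k w|)
      = (Num.sqrt N%:R * eta < `|T%:R^-1 * \sum_t x i t k w|).
    by rewrite e -mulrA normrM gtr0_norm ?invr_gt0 // ltr_pdivlMl.
  by apply/seteqP; split=> w; rewrite /= e2.
rewrite eqset; apply: le_trans (markov_powR q0 (mulr_gt0 sN eta0) mV1) _.
rewrite powRM ?sqrtr_ge0 ?(ltW eta0) //.
have -> : Num.sqrt N%:R `^ q = N%:R `^ (r / 4) :> R.
  by rewrite -powR12_sqrt // -powRrM; congr (_ `^ _); field.
by rewrite ler_wpM2r // invr_ge0 mulr_ge0 ?powR_ge0.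
Qed.

End fourth_moments.

End panel_moments.

(** * Probability of the two events *)

Section panel_events.
Context {d : measure_display} {Omega : measurableType d} {R : realType}.
Variable P : probability Omega R.
Context {N T p : nat}.
Variables (r : R) (x : 'I_N -> 'I_T -> 'I_p -> Omega -> R)
  (eps : 'I_N -> 'I_T -> Omega -> R) (i1 : 'I_N).
Hypotheses (r2 : 2 <= r) (N_gt0 : (0 < N)%N) (T_gt0 : (0 < T)%N) (p_gt0 : (0 < p)%N).
Hypotheses (mx : forall i t k, measurable_fun setT (x i t k))
  (me : forall i t, measurable_fun setT (eps i t)).
Hypotheses (A1 : assumption_A1 P x eps) (A2 : assumption_A2a P x eps r i1).

Local Notation sigma := (max_Lrnorm P r (eps i1)).
Local Notation C := (moment_const r).
Variables (a lam mu : R).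
Hypotheses (a_gt0 : 0 < a) (sigma_gt0 : 0 < sigma).
Hypothesis lamE : lam = 4 * a * p%:R `^ (1 / r) * (N%:R * T%:R) `^ (1 / 2) * sigma.
Hypothesis muE : mu = 4 * a * N%:R `^ (1 / r) * T%:R `^ (1 / 2) * sigma.

Let r0 : 0 < r. Proof. by rewrite (lt_le_trans _ r2). Qed.
Let pR : 0 < p%:R :> R. Proof. by rewrite ltr0n. Qed.
Let NR : 0 < N%:R :> R. Proof. by rewrite ltr0n. Qed.
Let TR : 0 < T%:R :> R. Proof. by rewrite ltr0n. Qed.
Let C_ge1 : 1 <= C.
Proof.
have h := powR_const_ge1 (ltW r0); rewrite /moment_const.
have : 1 <= expR (powR_const r) by rewrite -[leLHS]expR0 ler_expR (le_trans ler01).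
nra.
Qed.

Let powR_level (n m : R) : 0 < n -> 0 < m ->
  (4 * a * n `^ (1 / r) * m `^ (1 / 2) * sigma / 2) `^ r =
  (2 * a) `^ r * n * m `^ (r / 2) * sigma `^ r.
Proof.
move=> n0 m0.
have -> : 4 * a * n `^ (1 / r) * m `^ (1 / 2) * sigma / 2 =
    2 * a * n `^ (1 / r) * m `^ (1 / 2) * sigma by field.
have a20 : 0 <= 2 * a by rewrite mulr_ge0 // ltW.
have split4 (w1 w2 w3 w4 : R) : 0 <= w1 -> 0 <= w2 -> 0 <= w3 -> 0 <= w4 ->
    (w1 * w2 * w3 * w4) `^ r = w1 `^ r * w2 `^ r * w3 `^ r * w4 `^ r.
  by move=> *; rewrite !powRM ?mulr_ge0.
rewrite split4 ?powR_ge0 ?(ltW sigma_gt0) //.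
rewrite -[(n `^ _) `^ r]powRrM -[(m `^ _) `^ r]powRrM.
rewrite !mul1r mulVf ?gt_eqF // powRr1 ?(ltW n0) //.
by rewrite [2^-1 * r]mulrC.
Qed.

Lemma covariate_tr_error k w :
  ((covariate_matrix x w)^T *m stacked_vector eps w) k 0 =
  \sum_i \sum_t x i t k w * eps i t w.
Proof.
rewrite stack_tr_mul summxE; apply: eq_bigr => i _.
by rewrite mxE; apply: eq_bigr => t _; rewrite !mxE.
Qed.

Lemma dummies_tr_error i w :
  ((dummies R N T)^T *m stacked_vector eps w) i 0 = \sum_t eps i t w.
Proof. by rewrite dummies_tr_stackE; apply: eq_bigr => t _; rewrite mxE. Qed.

Let lam_gt0 : 0 < lam.
Proof. by rewrite lamE !mulr_gt0 ?powR_gt0 ?mulr_gt0. Qed.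

Let mu_gt0 : 0 < mu.
Proof. by rewrite muE !mulr_gt0 ?powR_gt0 ?mulr_gt0. Qed.

Let event_AE : event_A x eps lam mu =
  ~` ((\bigcup_(k in [set: 'I_p]) [set w | lam / 2 < `|\sum_i \sum_t x i t k w * eps i t w|])
      `|` (\bigcup_(i in [set: 'I_N]) [set w | mu / 2 < `|\sum_t eps i t w|])).
Proof.
have l2 : 0 <= lam / 2 by rewrite divr_ge0 // ltW.
have m2 : 0 <= mu / 2 by rewrite divr_ge0 // ltW.
apply/seteqP; split=> w.
  move=> [hA hB] [[k _ /=]|[i _ /=]]; rewrite ltNge => /negP; apply.
    by rewrite -covariate_tr_error (le_trans (linfnorm_ge _ _)).
  by rewrite -dummies_tr_error (le_trans (linfnorm_ge _ _)).
move=> h; split; rewrite linfnorm_le //; apply/forallP => k; rewrite leNgt;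
  apply/negP => hk; apply: h; [left|right]; exists k => //=.
  by rewrite -covariate_tr_error.
by rewrite -dummies_tr_error.
Qed.

Let mscore k : moment_finite P r (fun w => \sum_i \sum_t x i t k w * eps i t w).
Proof. exact: (score_sum_moment r2 T_gt0 mx me A1 A2 k N_gt0).1. Qed.

Let merror i : moment_finite P r (fun w => \sum_t eps i t w).
Proof. exact: (error_sum_moment r2 T_gt0 mx me A1 A2 i).1. Qed.

Lemma measurable_event_A : measurable (event_A x eps lam mu).
Proof.
rewrite event_AE; apply: measurableC; apply: measurableU;
  apply: fin_bigcup_measurable => // k _; apply: measurable_norm_gt.
  exact: (mscore k).1.
exact: (merror k).1.
Qed.

(** The penalty levels are calibrated so that the tail bounds of the [p]
    coordinates of [X' eps] are all equal, and so are those of [D' eps]; the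
    union bound then cancels [p] and [N]. *)
Lemma event_A_prob :
  1 - 2 * (C ^+ 2 / a) `^ r <= fine (P (event_A x eps lam mu)).
Proof.
pose bad (j : 'I_p + 'I_N) : set Omega := match j with
  | inl k => [set w | lam / 2 < `|\sum_i \sum_t x i t k w * eps i t w|]
  | inr i => [set w | mu / 2 < `|\sum_t eps i t w|] end.
have mbad j : measurable (bad j).
  case: j => [k|i]; apply: measurable_norm_gt; first exact: (mscore k).1.
  exact: (merror i).1.
have cover w : ~ event_A x eps lam mu w -> exists j, bad j w.
  rewrite event_AE /= => /contrapT [[k _ h]|[i _ h]]; first by exists (inl k).
  by exists (inr i).
have Ca : 0 < (2 * a) `^ r by rewrite powR_gt0 // mulr_gt0.
have sr : 0 < sigma `^ r by exact: powR_gt0.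
have bl k : fine (P (bad (inl k))) <= C ^+ 2 / (2 * a) `^ r / p%:R.
  have l2 : 0 < lam / 2 by rewrite divr_gt0.
  apply: le_trans (markov_powR r0 l2 (mscore k)) _.
  have NTr : 0 < (N%:R * T%:R) `^ (r / 2) :> R by rewrite powR_gt0 // mulr_gt0.
  rewrite ler_pdivrMr ?powR_gt0 // lamE powR_level ?mulr_gt0 //.
  apply: le_trans (score_sum_moment r2 T_gt0 mx me A1 A2 k N_gt0).2 _.
  by rewrite le_eqVlt; apply/orP; left; apply/eqP; field; rewrite !gt_eqF.
have br i : fine (P (bad (inr i))) <= C ^+ 2 / (2 * a) `^ r / N%:R.
  have m2 : 0 < mu / 2 by rewrite divr_gt0.
  apply: le_trans (markov_powR r0 m2 (merror i)) _.
  have Tr : 0 < T%:R `^ (r / 2) :> R by rewrite powR_gt0.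
  rewrite ler_pdivrMr ?powR_gt0 // muE powR_level //.
  apply: le_trans (error_sum_moment r2 T_gt0 mx me A1 A2 i).2 _.
  have -> : C ^+ 2 / (2 * a) `^ r / N%:R * ((2 * a) `^ r * N%:R * T%:R `^ (r / 2) * sigma `^ r)
      = C ^+ 2 * T%:R `^ (r / 2) * sigma `^ r by field; rewrite !gt_eqF.
  by rewrite !ler_wpM2r ?powR_ge0 // expr2 ler_peMl // (le_trans ler01).
apply: le_trans _ (union_bound P measurable_event_A mbad cover).
rewrite lerD2l lerN2 big_sumType /=.
have h1 : \sum_(k < p) fine (P (bad (inl k))) <= C ^+ 2 / (2 * a) `^ r.
  apply: (@le_trans _ _ (\sum_(k < p) C ^+ 2 / (2 * a) `^ r / p%:R)).
    by apply: ler_sum => k _; exact: bl.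
  by rewrite sumr_const card_ord -[leLHS]mulr_natr divfK ?gt_eqF.
have h2 : \sum_(i < N) fine (P (bad (inr i))) <= C ^+ 2 / (2 * a) `^ r.
  apply: (@le_trans _ _ (\sum_(k < N) C ^+ 2 / (2 * a) `^ r / N%:R)).
    by apply: ler_sum => k _; exact: br.
  by rewrite sumr_const card_ord -[leLHS]mulr_natr divfK ?gt_eqF.
have C2 : 1 <= C ^+ 2 by rewrite exprn_ege1.
have h3 : C ^+ 2 / (2 * a) `^ r <= (C ^+ 2 / a) `^ r.
  rewrite [leRHS]powRM ?invr_ge0 ?(ltW a_gt0) ?(le_trans ler01) //.
  rewrite powR_invl ?(ltW a_gt0) //.
  have r1 : 1 <= r by rewrite (le_trans _ r2) // ler1n.
  apply: ler_pM; [exact: sqr_ge0|by rewrite invr_ge0 powR_ge0|exact: le1r_powR|].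
  rewrite lef_pV2 ?posrE ?powR_gt0 ?mulr_gt0 //.
  apply: (ge0_ler_powR (ltW r0)); rewrite ?nnegrE ?mulr_ge0 ?(ltW a_gt0) //.
  by rewrite ler_peMl ?ler1n // ltW.
lra.
Qed.

Let levelE (n m : R) : 0 < n -> 0 < m ->
  4 * a * n `^ (1 / r) * m `^ (1 / 2) * sigma / Num.sqrt m =
  4 * a * sigma * n `^ (1 / r).
Proof.
move=> n0 m0; have s0 : 0 < Num.sqrt m by rewrite sqrtr_gt0.
have -> : m `^ (1 / 2) = Num.sqrt m by rewrite -powR12_sqrt ?ltW // div1r.
by field; rewrite gt_eqF.
Qed.

Lemma scaled_levels :
  lam / Num.sqrt (N%:R * T%:R) = 4 * a * sigma * p%:R `^ (1 / r) /\
  mu / Num.sqrt T%:R = 4 * a * sigma * N%:R `^ (1 / r).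
Proof. by rewrite lamE muE !levelE // mulr_gt0. Qed.

Local Notation imbalance := (Num.max (p%:R / N%:R) (N%:R / p%:R) : R).

(** The scaled penalty levels are proportional to [p `^ (1 / r)] and
    [N `^ (1 / r)], so the [r]-th power of their ratio, larger over smaller, is
    the larger of [p / N] and [N / p]. *)
Lemma scaled_level_bounds : exists lo hi : R,
  [/\ 0 < lo, lo <= lam / Num.sqrt (N%:R * T%:R) <= hi,
      lo <= mu / Num.sqrt T%:R <= hi &
      0 < (hi / lo) ^+ 2 /\ ((hi / lo) ^+ 2) `^ (r / 2) <= imbalance].
Proof.
have [-> ->] := scaled_levels.
have b0 : 0 < 4 * a * sigma by rewrite !mulr_gt0.
have pr : 0 < p%:R `^ (1 / r) :> R by exact: powR_gt0.
have Nr : 0 < N%:R `^ (1 / r) :> R by exact: powR_gt0.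
have ratio (m n : R) : 0 < m -> 0 < n ->
    0 < (4 * a * sigma * n `^ (1 / r) / (4 * a * sigma * m `^ (1 / r))) ^+ 2 /\
    ((4 * a * sigma * n `^ (1 / r) / (4 * a * sigma * m `^ (1 / r))) ^+ 2) `^ (r / 2) = n / m.
  move=> m0 n0.
  have mr : 0 < m `^ (1 / r) by exact: powR_gt0.
  have nr : 0 < n `^ (1 / r) by exact: powR_gt0.
  have -> : 4 * a * sigma * n `^ (1 / r) / (4 * a * sigma * m `^ (1 / r)) = (n / m) `^ (1 / r).
    rewrite [RHS]powRM ?invr_ge0 ?ltW //.
    rewrite powR_invl ?ltW //.
    by field; rewrite !gt_eqF.
  have nm0 : 0 < n / m by rewrite divr_gt0.
  split; first by rewrite exprn_gt0 // powR_gt0.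
  rewrite -powR_mulrn ?powR_ge0 // -!powRrM.
  have -> : 1 / r * (2%:R * (r / 2)) = 1 by field; rewrite gt_eqF.
  by rewrite powRr1 // ltW.
have mono (m n : R) : 0 < m -> 0 < n -> m <= n -> 4 * a * sigma * m `^ (1 / r) <= 4 * a * sigma * n `^ (1 / r).
  move=> m0 n0 mn; rewrite ler_wpM2l ?(ltW b0) //.
  have ir : 0 <= 1 / r by rewrite divr_ge0 // ltW.
  by apply: (ge0_ler_powR ir); rewrite ?nnegrE ?(ltW m0) ?(ltW n0).
have [pN|Np] := lerP (p%:R : R) N%:R.
  exists (4 * a * sigma * p%:R `^ (1 / r)), (4 * a * sigma * N%:R `^ (1 / r)).
  have [h1 h2] := ratio _ _ pR NR.
  have h3 := mono _ _ pR NR pN.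
  split; rewrite ?lexx ?h3 //; first by rewrite mulr_gt0.
  by split=> //; rewrite h2 le_max lexx orbT.
exists (4 * a * sigma * N%:R `^ (1 / r)), (4 * a * sigma * p%:R `^ (1 / r)).
have [h1 h2] := ratio _ _ NR pR.
have h3 := mono _ _ NR pR (ltW Np).
split; rewrite ?lexx ?h3 //; first by rewrite mulr_gt0.
by split=> //; rewrite h2 le_max lexx.
Qed.

Lemma Psi_entry_uu k l w : Psi (covariate_matrix x w) (lshift N k) (lshift N l) =
  N%:R^-1 * \sum_i (T%:R^-1 * \sum_t x i t k w * x i t l w).
Proof.
rewrite Psi_block // block_mxEul mxE invfM -mulrA; congr (_ * _).
rewrite stack_tr_mul summxE mulr_sumr; apply: eq_bigr => i _; congr (_ * _).
by rewrite mxE; apply: eq_bigr => t _; rewrite !mxE.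
Qed.

Lemma covariate_tr_dummies k i w :
  ((covariate_matrix x w)^T *m dummies R N T) k i = \sum_t x i t k w.
Proof.
have -> : (covariate_matrix x w)^T *m dummies R N T =
    ((dummies R N T)^T *m covariate_matrix x w)^T by rewrite trmx_mul trmxK.
rewrite mxE.
by rewrite dummies_tr_stackE; apply: eq_bigr => t _; rewrite mxE.
Qed.

Lemma Psi_entry_ud k i w : Psi (covariate_matrix x w) (lshift N k) (rshift p i) =
  (Num.sqrt (N%:R * T%:R) * Num.sqrt T%:R)^-1 * \sum_t x i t k w.
Proof. by rewrite Psi_block // block_mxEur mxE covariate_tr_dummies. Qed.

Lemma Psi_entry_du k i w : Psi (covariate_matrix x w) (rshift p i) (lshift N k) =
  (Num.sqrt (N%:R * T%:R) * Num.sqrt T%:R)^-1 * \sum_t x i t k w.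
Proof. by rewrite Psi_block // block_mxEdl mxE [X in _ * X]mxE covariate_tr_dummies. Qed.

Lemma Psi_entry_dd i j w :
  Psi (covariate_matrix x w) (rshift p i) (rshift p j) = (i == j)%:R.
Proof. by rewrite Psi_block // block_mxEdr mxE. Qed.

Lemma measurable_Psi i j :
  measurable_fun setT (fun w => Psi (covariate_matrix x w) i j).
Proof.
have msum k l : measurable_fun setT (fun w => \sum_t x k t l w).
  by apply: measurable_sum => t; exact: mx.
case: (split_ordP i) => k ->; case: (split_ordP j) => l ->.
- under eq_fun do rewrite Psi_entry_uu.
  apply: measurable_funM => //; apply: measurable_sum => u.
  apply: measurable_funM => //; apply: measurable_sum => t.
  by apply: measurable_funM; exact: mx.
- by under eq_fun do rewrite Psi_entry_ud; apply: measurable_funM.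
- by under eq_fun do rewrite Psi_entry_du; apply: measurable_funM.
- by under eq_fun do rewrite Psi_entry_dd; exact: measurable_cst.
Qed.

Variables s1 s2 : nat.
Local Notation ksq := (kappa2 T lam mu (Gamma P x) s1 s2).
Local Notation cone := (@restricted_cone R N T p lam mu s1 s2).

Lemma cone_empty v : (s1 + s2 = 0)%N -> ~ cone v.
Proof.
move=> s0 cv; have [lo [hi [lo0 b1 b2 _]]] := scaled_level_bounds.
have := cone_l1norm_le lo0 b1 b2 cv; rewrite s0 mulr0 mul0r.
case: cv => v0 _ h; move/negP: v0; apply; apply/eqP/colP => i; rewrite mxE.
have : l1norm v = 0 by apply/eqP; rewrite -sqrf_eq0 eq_le h sqr_ge0.
by move/psumr_eq0P => /(_ _ i isT) /normr0_eq0; apply.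
Qed.

Let quad_delta n (M : 'M[R]_n) (j : 'I_n) :
  ((delta_mx j 0 : 'cV[R]_n)^T *m M *m (delta_mx j 0 : 'cV[R]_n)) 0 0 = M j j.
Proof. by rewrite trmx_delta -rowE -colE !mxE. Qed.

Let l2norm_delta n (j : 'I_n) : l2norm (delta_mx j 0 : 'cV[R]_n) ^+ 2 = 1.
Proof.
rewrite sqr_l2norm (bigD1 j) //= big1 ?addr0 => [|i /negbTE ij].
  by rewrite mxE !eqxx expr1n.
by rewrite mxE ij expr0n.
Qed.

Let delta_off n (A : {set 'I_n}) j : j \notin A -> l1norm_on A (delta_mx j 0 : 'cV[R]_n) = 0.
Proof.
move=> jA; apply: big1 => i iA; rewrite mxE; case: eqP => [e|]; last by rewrite normr0.
by rewrite -e iA in jA.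
Qed.

(** Coordinate vectors lie in the cone, and the diagonal of [Gamma] is at most
    one. *)
Lemma ksq_le1 : (0 < s1 + s2)%N -> (ksq <= 1)%E.
Proof.
have L1 : 0 <= lam / Num.sqrt (N%:R * T%:R) by rewrite divr_ge0 ?sqrtr_ge0 // ltW.
have L2 : 0 <= mu / Num.sqrt T%:R by rewrite divr_ge0 ?sqrtr_ge0 // ltW.
have zero n (A : {set 'I_n}) : l1norm_on A (0 : 'cV[R]_n) = 0.
  by apply: big1 => i _; rewrite mxE normr0.
have delta0 n (j : 'I_n) : (delta_mx j 0 : 'cV[R]_n) != 0.
  by apply/eqP => /colP/(_ j)/eqP; rewrite !mxE !eqxx oner_eq0.
move=> s0; have [s10|s10] := posnP s1.
  have s20 : (0 < s2)%N by move: s0; rewrite s10.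
  pose i : 'I_N := Ordinal N_gt0.
  have e : (delta_mx (rshift p i) 0 : 'cV[R]_(p + N)) = col_mx 0 (delta_mx i 0).
    apply/colP => j; case: (split_ordP j) => k ->; rewrite ?col_mxEu ?col_mxEd !mxE.
      by rewrite eq_lrshift.
    by rewrite eq_rshift.
  have cv : cone (delta_mx (rshift p i) 0).
    split; first exact: delta0.
    exists (finset.set0), [set i]%SET; rewrite cards0 cards1 s20 leq0n; split=> //.
    rewrite e col_mxKu col_mxKd !zero !mulr0 !add0r delta_off ?mulr0 ?inE ?eqxx //.
    by apply: mulr_ge0; [apply: mulr_ge0|exact: l1norm_on_ge0].
  apply: le_trans (kappa2_le (Gamma P x) cv) _.
  by rewrite quad_delta l2norm_delta divr1 lee_fin /Gamma block_mxEdr mxE eqxx.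
pose k : 'I_p := Ordinal p_gt0.
have e : (delta_mx (lshift N k) 0 : 'cV[R]_(p + N)) = col_mx (delta_mx k 0) 0.
  apply/colP => j; case: (split_ordP j) => l ->; rewrite ?col_mxEu ?col_mxEd !mxE.
    by rewrite eq_lshift.
  by rewrite eq_rlshift.
have cv : cone (delta_mx (lshift N k) 0).
  split; first exact: delta0.
  exists [set k]%SET, (finset.set0); rewrite cards0 cards1 s10 leq0n; split=> //.
  rewrite e col_mxKu col_mxKd !zero !mulr0 !addr0 delta_off ?mulr0 ?inE ?eqxx //.
  by apply: mulr_ge0; [apply: mulr_ge0|exact: l1norm_on_ge0].
apply: le_trans (kappa2_le (Gamma P x) cv) _.
rewrite quad_delta l2norm_delta divr1 lee_fin.
exact: (Gamma_diag_le1 r2 T_gt0 mx me A1 A2).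
Qed.

Hypothesis ksq_gt0 : (0 < ksq)%E.

Let ksq_fin : (0 < s1 + s2)%N -> ksq = (fine ksq)%:E /\ 0 < fine ksq <= 1.
Proof.
move=> s0; have k1 := ksq_le1 s0.
have kf : ksq \is a fin_num.
  by rewrite ge0_fin_numE ?(ltW ksq_gt0) // (le_lt_trans k1) ?ltry.
split; first by rewrite fineK.
apply/andP; split; first by rewrite fine_gt0 // ksq_gt0 (le_lt_trans k1) ?ltry.
by rewrite -lee_fin fineK.
Qed.

Lemma measurable_event_B : measurable (event_B P x lam mu s1 s2).
Proof.
have [s0|s0] := posnP (s1 + s2)%N.
  rewrite (_ : event_B _ _ _ _ _ _ = setT) //.
  apply/seteqP; split=> // w _; rewrite /event_B /=.
  by rewrite [leRHS]kappa2_set0 ?leey // => v; exact: cone_empty.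
have [kE _] := ksq_fin s0.
have -> : event_B P x lam mu s1 s2 =
    [set w | forall v, cone v -> fine ksq / 2 * l2norm v ^+ 2 <=
      (v^T *m Psi (covariate_matrix x w) *m v) 0 0].
  apply/seteqP; split=> w; rewrite /event_B /= kE -EFinM; first by move/kappa2_geP.
  by move=> h; apply/kappa2_geP.
exact: measurable_quadratic_event measurable_Psi _ _.
Qed.

Local Notation D := (32 `^ (r / 2) * (moment_const (r / 2) * 2 `^ (r / 2 + 1)) : R).

Let moment_factor_ge1 : 1 <= moment_const (r / 2) * 2 `^ (r / 2 + 1).
Proof.
have q0 : 0 <= r / 2 by rewrite divr_ge0 // ltW.
have h := powR_const_ge1 q0.
have h2 : 1 <= expR (powR_const (r / 2)) by rewrite -[leLHS]expR0 ler_expR (le_trans ler01).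
have h3 : 1 <= moment_const (r / 2) by rewrite /moment_const; nra.
have h4 : 1 <= 2 `^ (r / 2 + 1) :> R.
  by rewrite -[leLHS](powRr0 2) ler_powR ?ler1n // addr_ge0.
nra.
Qed.

Let imbalance_gt0 : 0 < imbalance.
Proof. by rewrite lt_max divr_gt0. Qed.

Let sqrt_powR k : 0 <= k -> Num.sqrt k `^ r = k `^ (r / 2).
Proof. by move=> k0; rewrite -powR12_sqrt // -powRrM mulrC. Qed.

(** As [fine ksq <= 1], it suffices that [N `^ (r / 4) <= N ^+ 2], and
    [N ^+ 2 <= N * p * (N / p)]. *)
Lemma remainder_ge1 : (0 < s1 + s2)%N -> r < 4 ->
  1 <= D * ((p%:R ^+ 2 + N%:R * p%:R) * (s1 + s2)%:R `^ (r / 2) * imbalance)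
        / (Num.sqrt (fine ksq) `^ r * N%:R `^ (r / 4)).
Proof.
move=> s0 r4; have [_ /andP[K0 K1]] := ksq_fin s0.
have q0 : 0 < r / 2 by rewrite divr_gt0.
rewrite sqrt_powR ?(ltW K0) // ler_pdivlMr ?mulr_gt0 ?powR_gt0 // mul1r.
have N1 : 1 <= N%:R :> R by rewrite ler1n.
have KK : fine ksq `^ (r / 2) <= 1.
  apply: (@le_trans _ _ (1 `^ (r / 2))); last by rewrite powR1.
  by rewrite ge0_ler_powR ?nnegrE ?(ltW K0) ?(ltW q0).
have NN : N%:R `^ (r / 4) <= N%:R ^+ 2 :> R.
  by rewrite -powR_mulrn // ler_powR // ler_pdivrMr //; lra.
have ss : 1 <= (s1 + s2)%:R `^ (r / 2) :> R.
  apply: (@le_trans _ _ (1 `^ (r / 2))); first by rewrite powR1.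
  by rewrite ge0_ler_powR ?nnegrE ?(ltW q0) // ler1n.
have D1 : 1 <= D.
  have h : 1 <= 32 `^ (r / 2) :> R by rewrite -[leLHS](powRr0 32) ler_powR ?ler1n // ltW.
  by rewrite -[leLHS]mulr1 ler_pM.
have dims : N%:R ^+ 2 <= (p%:R ^+ 2 + N%:R * p%:R) * imbalance.
  have pN : N%:R ^+ 2 = N%:R * p%:R * (N%:R / p%:R) :> R by field; rewrite gt_eqF.
  rewrite pN; apply: ler_pM; rewrite ?mulr_ge0 ?divr_ge0 ?(ltW pR) //.
    by rewrite lerDr sqr_ge0.
  by rewrite le_max lexx orbT.
apply: (@le_trans _ _ (N%:R ^+ 2)).
  by rewrite -[leRHS]mul1r ler_pM ?powR_ge0.
apply: (le_trans dims).
have i0 : 0 <= (p%:R ^+ 2 + N%:R * p%:R) * imbalance by apply: le_trans dims; exact: sqr_ge0.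
rewrite -[leLHS]mul1r; apply: ler_pM => //.
have -> : (p%:R ^+ 2 + N%:R * p%:R) * (s1 + s2)%:R `^ (r / 2) * imbalance =
  (p%:R ^+ 2 + N%:R * p%:R) * imbalance * (s1 + s2)%:R `^ (r / 2) by ring.
by rewrite ler_peMr.
Qed.

(** The event contains the one where all entries of [Psi] are within [eta] of
    those of [Gamma]; the off-diagonal blocks are transposes of each other and
    are counted once. *)
Lemma event_B_prob_ge4 : (0 < s1 + s2)%N -> 4 <= r ->
  1 - D * ((p%:R ^+ 2 + N%:R * p%:R) * (s1 + s2)%:R `^ (r / 2) * imbalance)
        / (Num.sqrt (fine ksq) `^ r * N%:R `^ (r / 4))
  <= fine (P (event_B P x lam mu s1 s2)).
Proof.
move=> s0 r4; have [kE /andP[K0 K1]] := ksq_fin s0.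
set K := fine ksq in kE K0 K1 *.
have [lo [hi [lo0 b1 b2 [rat0 ratq]]]] := scaled_level_bounds.
have sR : 0 < (s1 + s2)%:R :> R by rewrite ltr0n.
pose c := 16 * (hi / lo) ^+ 2 * (s1 + s2)%:R.
have c0 : 0 < c by apply: mulr_gt0 => //; apply: mulr_gt0.
(* The entrywise accuracy for which kappa2_perturb applies with constant c. *)
pose eta := K / (2 * c).
have eta0 : 0 < eta by rewrite divr_gt0 // mulr_gt0.
pose bad (j : 'I_p * 'I_p + 'I_p * 'I_N) : set Omega := match j with
  | inl kl => [set w | eta <
      `|N%:R^-1 * \sum_i (T%:R^-1 * \sum_t x i t kl.1 w * x i t kl.2 w)
        - Gamma P x (lshift N kl.1) (lshift N kl.2)|]
  | inr ki => [set w | eta <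
      `|(Num.sqrt (N%:R * T%:R) * Num.sqrt T%:R)^-1 * \sum_t x ki.2 t ki.1 w|] end.
have mbad j : measurable (bad j).
  case: j => [kl|ki]; apply: measurable_norm_gt.
    apply: measurable_funB => //; apply: measurable_funM => //.
    apply: measurable_sum => u; apply: measurable_funM => //.
    by apply: measurable_sum => t; apply: measurable_funM; exact: mx.
  by apply: measurable_funM => //; apply: measurable_sum => t; exact: mx.
have cover w : ~ event_B P x lam mu s1 s2 w -> exists j, bad j w.
  move=> nB; apply: contrapT => /forallNP nbad; apply: nB; rewrite /event_B /= kE -EFinM.
  apply: (@kappa2_perturb _ _ _ _ lam mu K c eta s1 s2 (Gamma P x)).
  - exact: ltW.
  - rewrite /eta le_eqVlt; apply/orP; left; apply/eqP; field; rewrite gt_eqF //.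
  - by move=> v cv; have := cone_l1norm_le lo0 b1 b2 cv.
  - move=> i j; case: (split_ordP i) => k ->; case: (split_ordP j) => l ->.
    + have := nbad (inl (k, l)); rewrite Psi_entry_uu /bad /= => /negP.
      by rewrite -leNgt.
    + have := nbad (inr (k, l)); rewrite Psi_entry_ud /bad /= => /negP.
      by rewrite -leNgt /Gamma block_mxEur [X in _ - X]mxE subr0.
    + have := nbad (inr (l, k)); rewrite Psi_entry_du /bad /= => /negP.
      by rewrite -leNgt /Gamma block_mxEdl [X in _ - X]mxE subr0.
    + by rewrite Psi_entry_dd /Gamma block_mxEdr [X in _ - X]mxE subrr normr0 ltW.
  - by rewrite kE.
apply: le_trans _ (union_bound P measurable_event_B mbad cover).
rewrite lerD2l lerN2 big_sumType /=.
set F := moment_const (r / 2) * 2 `^ (r / 2 + 1).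
pose G := F / (N%:R `^ (r / 4) * eta `^ (r / 2)).
have den0 : 0 < N%:R `^ (r / 4) * eta `^ (r / 2) by rewrite mulr_gt0 ?powR_gt0.
have h1 : \sum_(kl : 'I_p * 'I_p) fine (P (bad (inl kl))) <= p%:R ^+ 2 * G.
  apply: (@le_trans _ _ (\sum_(kl : 'I_p * 'I_p) G)).
    apply: ler_sum => kl _.
    exact: (gram_tail r2 T_gt0 mx me A1 A2 r4 N_gt0 kl.1 kl.2 eta0).
  by rewrite sumr_const card_prod !card_ord -[leLHS]mulr_natl natrM expr2.
have h2 : \sum_(ki : 'I_p * 'I_N) fine (P (bad (inr ki))) <= N%:R * p%:R * G.
  apply: (@le_trans _ _ (\sum_(ki : 'I_p * 'I_N) G)).
    apply: ler_sum => ki _.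
    apply: le_trans (time_sum_tail r2 T_gt0 mx me A1 A2 r4 N_gt0 ki.2 ki.1 eta0) _.
    by rewrite /G ler_wpM2r ?invr_ge0 ?(ltW den0) //; exact: moment_factor_ge1.
  by rewrite sumr_const card_prod !card_ord -[leLHS]mulr_natl natrM (mulrC p%:R).
apply: le_trans (lerD h1 h2) _; rewrite -mulrDl sqrt_powR ?(ltW K0) //.
have Kq : 0 < K `^ (r / 2) by exact: powR_gt0.
have Nq : 0 < N%:R `^ (r / 4) :> R by exact: powR_gt0.
have etaE : (eta `^ (r / 2))^-1 <=
    32 `^ (r / 2) * imbalance * (s1 + s2)%:R `^ (r / 2) / K `^ (r / 2).
  have -> : (eta `^ (r / 2))^-1 =
      (32 * (hi / lo) ^+ 2 * (s1 + s2)%:R) `^ (r / 2) / K `^ (r / 2).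
    rewrite -!powR_invl ?(ltW K0) ?(ltW eta0) // -powRM ?invr_ge0 ?(ltW K0) //; last first.
      by apply: mulr_ge0 => //; apply: mulr_ge0 => //; exact: ltW.
    have aux (u v z : R) : 0 < u -> 0 < v -> 0 < z ->
        (z / (2 * (16 * u * v)))^-1 = 32 * u * v / z.
      by move=> *; field; rewrite !gt_eqF.
    by congr (_ `^ _); rewrite /eta /c aux.
  rewrite ler_wpM2r ?invr_ge0 ?(ltW Kq) //.
  have rho0 := ltW rat0.
  rewrite powRM //; last by apply: mulr_ge0.
  rewrite powRM //.
  by rewrite ler_wpM2r ?powR_ge0 // ler_wpM2l ?powR_ge0.
have F0 : 0 <= F by apply: le_trans ler01 _; exact: moment_factor_ge1.
have dims0 : 0 <= p%:R ^+ 2 + N%:R * p%:R :> R by rewrite addr_ge0 ?sqr_ge0 ?mulr_ge0.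
have -> : 32 `^ (r / 2) * F * ((p%:R ^+ 2 + N%:R * p%:R) * (s1 + s2)%:R `^ (r / 2) * imbalance)
    / (K `^ (r / 2) * N%:R `^ (r / 4)) =
  (p%:R ^+ 2 + N%:R * p%:R) * (F / N%:R `^ (r / 4) *
    (32 `^ (r / 2) * imbalance * (s1 + s2)%:R `^ (r / 2) / K `^ (r / 2))).
  by field; rewrite !gt_eqF.
apply: ler_wpM2l => //.
have -> : G = F / N%:R `^ (r / 4) * (eta `^ (r / 2))^-1.
  by rewrite /G invfM mulrA.
by apply: ler_wpM2l => //; rewrite divr_ge0 // ltW.
Qed.

Lemma event_B_prob :
  1 - D * ((p%:R ^+ 2 + N%:R * p%:R) * (s1 + s2)%:R `^ (r / 2) * imbalance)
        / (Num.sqrt (fine ksq) `^ r * N%:R `^ (r / 4))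
  <= fine (P (event_B P x lam mu s1 s2)).
Proof.
have [s0|s0] := posnP (s1 + s2)%N.
  rewrite (_ : event_B _ _ _ _ _ _ = setT); last first.
    apply/seteqP; split=> // w _; rewrite /event_B /=.
    by rewrite [leRHS]kappa2_set0 ?leey // => v; exact: cone_empty.
  rewrite (_ : fine (P setT) = 1); last exact: (congr1 fine (@probability_setT _ _ _ P)).
  rewrite lerBlDr lerDl; apply: divr_ge0; last by rewrite mulr_ge0 ?powR_ge0.
  apply: mulr_ge0.
    apply: mulr_ge0; first exact: powR_ge0.
    by apply: le_trans ler01 _; exact: moment_factor_ge1.
  apply: mulr_ge0; last exact: ltW.
  apply: mulr_ge0; last exact: powR_ge0.
  by rewrite addr_ge0 ?sqr_ge0 ?mulr_ge0.
have [r4|r4] := lerP 4 r; first exact: event_B_prob_ge4.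
have := remainder_ge1 s0 r4.
have : 0 <= fine (P (event_B P x lam mu s1 s2)) by rewrite fine_ge0.
lra.
Qed.

Lemma event_AB_prob :
  1 - 2 * (C ^+ 2 / a) `^ r
    - D * ((p%:R ^+ 2 + N%:R * p%:R) * (s1 + s2)%:R `^ (r / 2) * imbalance)
        / (Num.sqrt (fine ksq) `^ r * N%:R `^ (r / 4))
  <= fine (P (event_A x eps lam mu `&` event_B P x lam mu s1 s2)).
Proof.
have mA := measurable_event_A; have mB := measurable_event_B.
pose bad (b : bool) :=
  if b then ~` event_A x eps lam mu else ~` event_B P x lam mu s1 s2.
have mbad b : measurable (bad b) by case: b; exact: measurableC.
have cover w : ~ (event_A x eps lam mu `&` event_B P x lam mu s1 s2) w ->
    exists b, bad b w.
  by move=> /not_andP[h|h]; [exists true|exists false].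
have compl S : measurable S -> fine (P (~` S)) = 1 - fine (P S).
  move=> mS; have := probability_setC P mS => ->.
  by rewrite fineB ?fin_num_measure.
have := union_bound P (measurableI _ _ mA mB) mbad cover.
rewrite big_bool /= !compl //.
have := event_A_prob; have := event_B_prob; lra.
Qed.

End panel_events.

Theorem theorem2 (R : realType) (r : R) (r_ge2 : 2 <= r) :
  exists C D : R, 0 < C /\ 0 < D /\
  forall (d : measure_display) (Omega : measurableType d)
    (P : probability Omega R)
    (N T p : nat) (N_gt0 : (0 < N)%N) (T_gt0 : (0 < T)%N) (p_gt0 : (0 < p)%N)
    (x : 'I_N -> 'I_T -> 'I_p -> {RV P >-> R})
    (eps : 'I_N -> 'I_T -> {RV P >-> R})
    (beta : 'cV[R]_p) (c : 'cV[R]_N)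
    (y : 'I_N -> 'I_T -> Omega -> R)
    (a : nat -> nat -> R) (lam mu : R),
  let i1 : 'I_N := Ordinal N_gt0 in
  let sigma := max_Lrnorm P r (eps i1) in
  let s1 := sparsity beta in
  let s2 := sparsity c in
  let ksq := kappa2 T lam mu (Gamma P x) s1 s2 in
  let kappa := Num.sqrt (fine ksq) in
  let xi := 32 * a N T * sigma *
            (p%:R `^ (1 / r) * Num.sqrt s1%:R +
             N%:R `^ (1 / r) * Num.sqrt s2%:R) / fine ksq in
  let AB := event_A x eps lam mu `&` event_B P x lam mu s1 s2 in
  (forall i t w, y i t w =
     \sum_(k < p) x i t k w * beta k 0 + c i 0 + eps i t w) ->
  assumption_A1 P x eps ->
  assumption_A2a P x eps r i1 ->
  (forall n m, 0 < a n m) ->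
  lam = 4 * a N T * p%:R `^ (1 / r) * (N%:R * T%:R) `^ (1 / 2) * sigma ->
  mu = 4 * a N T * N%:R `^ (1 / r) * T%:R `^ (1 / 2) * sigma ->
  (0 < ksq)%E ->
  (0 < sigma ->
   ((1 - 2 * (C / a N T) `^ r
       - D * ((p%:R ^+ 2 + N%:R * p%:R) * (s1 + s2)%:R `^ (r / 2)
              * Num.max (p%:R / N%:R) (N%:R / p%:R))
           / (kappa `^ r * N%:R `^ (r / 4)))%:E <= P AB)%E)
  /\
  (forall w, AB w ->
     forall (bhat : 'cV[R]_p) (chat : 'cV[R]_N),
     is_panel_lasso (covariate_matrix x w) (stacked_vector y w) lam mu bhat chat ->
     l2norm (bhat - beta) <= xi / Num.sqrt (N%:R * T%:R) /\
     l2norm (chat - c) <= xi / Num.sqrt T%:R).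
Proof.
have r0 : 0 < r by rewrite (lt_le_trans _ r_ge2).
have q0 : 0 < r / 2 by rewrite divr_gt0.
(* The factor 32 comes from the choice of the accuracy eta in
   event_B_prob_ge4: twice the constant 16 of cone_l1norm_le. *)
exists (moment_const r ^+ 2),
  (32 `^ (r / 2) * (moment_const (r / 2) * 2 `^ (r / 2 + 1))).
split; first by rewrite exprn_gt0 // moment_const_gt0 // ltW.
split.
  apply: mulr_gt0; first exact: powR_gt0.
  by apply: mulr_gt0; rewrite ?powR_gt0 // moment_const_gt0 // ltW.
move=> d Omega P N T p N_gt0 T_gt0 p_gt0 x eps beta c y a lam mu.
move=> i1 sigma s1 s2 ksq kappa xi AB yE A1 A2 a_gt0 lamE muE ksq_gt0.
have mx i t k : measurable_fun setT (x i t k) by exact: measurable_funPT.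
have me i t : measurable_fun setT (eps i t) by exact: measurable_funPT.
split=> [sigma_gt0|w [[Xe De] Bw] bhat chat lasso].
  have aT := a_gt0 N T.
  have mA := measurable_event_A r_ge2 N_gt0 T_gt0 p_gt0 mx me A1 A2 aT sigma_gt0
    lamE muE.
  have mB := measurable_event_B r_ge2 N_gt0 T_gt0 p_gt0 mx me A1 A2 aT sigma_gt0
    lamE muE ksq_gt0.
  have := event_AB_prob r_ge2 N_gt0 T_gt0 p_gt0 mx me A1 A2 aT sigma_gt0 lamE muE
    ksq_gt0.
  have fAB : P AB \is a fin_num.
    by rewrite /AB fin_num_measure //; exact (measurableI _ _ mA mB).
  by rewrite -lee_fin fineK.
have TR : 0 < T%:R :> R by rewrite ltr0n.
have NTR : 0 < N%:R * T%:R :> R by rewrite mulr_gt0 ?ltr0n.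
have sigma0 : 0 <= sigma by apply: (sigma_ge0 P r (fun i t => eps i t) i1 T_gt0).
have a0 := ltW (a_gt0 N T).
have lam0 : 0 <= lam.
  by rewrite lamE; do 4?[apply: mulr_ge0 => //]; exact: powR_ge0.
have mu0 : 0 <= mu.
  by rewrite muE; do 4?[apply: mulr_ge0 => //]; exact: powR_ge0.
have yZ : stacked_vector y w =
    row_mx (covariate_matrix x w) (dummies R N T) *m col_mx beta c
    + stacked_vector eps w.
  rewrite mul_row_col dummies_mul /covariate_matrix /stacked_vector /stack.
  rewrite mxcol_mul -!mxcolD; apply: eq_mxcol => i; apply/matrixP => t j.
  rewrite !mxE yE ord1; congr (_ + _ + _).
  by apply: eq_bigr => k _; rewrite mxE.
have err := lasso_error N_gt0 T_gt0 lam0 mu0 Xe De yZ lasso erefl ksq_gt0 Bw.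
apply: lasso_parts => //; apply: le_trans err _.
have level (n m : R) : 0 < m ->
    4 * a N T * n * m `^ (1 / 2) * sigma / Num.sqrt m = 4 * a N T * sigma * n.
  move=> m0; have s0 : 0 < Num.sqrt m by rewrite sqrtr_gt0.
  have -> : m `^ (1 / 2) = Num.sqrt m by rewrite -powR12_sqrt ?ltW // div1r.
  by field; rewrite gt_eqF.
have -> : lam / Num.sqrt (N%:R * T%:R) = 4 * a N T * sigma * p%:R `^ (1 / r).
  by rewrite lamE level.
have -> : mu / Num.sqrt T%:R = 4 * a N T * sigma * N%:R `^ (1 / r).
  by rewrite muE level.
rewrite /xi ler_wpM2r ?invr_ge0 ?fine_ge0 ?(ltW ksq_gt0) //.
rewrite -!(mulrA (4 * a N T * sigma)) -mulrDr.
set S := _ + _; have S0 : 0 <= S by rewrite addr_ge0 // mulr_ge0 ?powR_ge0 ?sqrtr_ge0.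
have aS : 0 <= a N T * sigma * S by rewrite !mulr_ge0.
lra.
Qed.
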